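(* Let $\mathbf{A}$ be a finite simple non-abelian Mal'cev algebra and let $\mathbf{B}$ be the countable atomless Boolean algebra, whose Stone space is the Cantor space $2^\omega$. Let $n\geq 0$, let $\mathbf{e}=(e_1,\dots,e_n)$ be a (possibly empty) tuple of idempotents of $\mathbf{A}$, and let $\mathbf{x}=(x_1,\dots,x_n)$ be a tuple of distinct points of $2^\omega$. Then the automorphism group of the filtered Boolean power $(\mathbf{A}^{\mathbf{B}})^{\mathbf{x}}_{\mathbf{e}}$ has ample generics.
   Context: An algebra $\mathbf{A}$ is a set $A$ with finitary operations. It is simple if $|A|>1$ and its only congruences are the equality relation and the total relation. It is Mal'cev if it has a ternary term operation $m$ with $m(x,x,y)=y=m(y,x,x)$ for all $x,y$. A Mal'cev algebra is abelian (in the sense of commutator theory) if it is polynomially equivalent to a module, i.e. all its operations are affine over some module; otherwise it is non-abelian (for groups this is the usual notion; a ring is abelian iff its multiplication is constantly $0$). An element $e\in A$ is an idempotent if $\{e\}$ is a subuniverse of $\mathbf{A}$. For a Boolean algebra $\mathbf{B}$ with Stone space $X$ and a finite algebra $\mathbf{A}$ (with discrete topology), the Boolean power $\mathbf{A}^{\mathbf{B}}$ is the subalgebra of $\mathbf{A}^X$ consisting of all continuous $f\colon X\to A$; the filtered Boolean power $(\mathbf{A}^{\mathbf{B}})^{\mathbf{x}}_{\mathbf{e}}$ is its subalgebra $\{f\in A^{\mathbf{B}}: f(x_i)=e_i \text{ for all } i\in[n]\}$. Automorphism groups of countable structures carry the topology of pointwise convergence. For a topological group $G$ and $n\in\mathbb{N}$,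 $G$ acts on $G^n$ by diagonal conjugation $(h_1,\dots,h_n)^g=(g^{-1}h_1g,\dots,g^{-1}h_ng)$; a tuple $\mathbf{h}\in G^n$ is generic if its orbit under this action is comeagre in $G^n$; $G$ has ample generics if it has a generic $n$-tuple for every $n\in\mathbb{N}$. *)

(* Defs.v *)
From HB Require Import structures.
From mathcomp Require Import all_boot all_order all_algebra.
From Stdlib Require Import FunctionalExtensionality.
From Stdlib Require List.

Set Implicit Arguments.
Unset Strict Implicit.
Unset Printing Implicit Defensive.

Import GRing.Theory.

Section Terms.
Variables (F : Type) (ar : F -> nat).

Inductive term (V : Type) : Type :=
| Var (v : V)
| App (f : F) (args : 'I_(ar f) -> term V).

Variables (A : Type) (op : forall f : F, ('I_(ar f) -> A) -> A).
Variable (V : Type).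

Fixpoint term_eval (v : V -> A) (t : term V) : A :=
  match t with
  | Var x => v x
  | App f args => @op f (fun i => term_eval v (args i))
  end.
End Terms.

Section Algebra.
Variables (F : Type) (ar : F -> nat).
Variables (A : Type) (op : forall f : F, ('I_(ar f) -> A) -> A).

Definition triple (a b c : A) : 'I_3 -> A :=
  fun i => match nat_of_ord i with 0 => a | 1 => b | _ => c end.

Definition malcev : Prop :=
  exists t : term ar 'I_3, forall a b : A,
    term_eval op (triple a a b) t = b /\ term_eval op (triple b a a) t = b.

Definition compatible (R : A -> A -> Prop) : Prop :=
  forall f (a b : 'I_(ar f) -> A),
    (forall i, R (a i) (b i)) -> R (@op f a) (@op f b).

Definition congruence (R : A -> A -> Prop) : Prop :=
  [/\ (forall a, R a a), (forall a b, R a b -> R b a),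
      (forall a b c, R a b -> R b c -> R a c) & compatible R].

Definition simple_alg : Prop :=
  (exists a b : A, a <> b) /\
  forall R, congruence R ->
    (forall a b, R a b <-> a = b) \/ (forall a b, R a b).

(* Abelian (for Mal'cev algebras): all operations are affine over some
   module M (over some ring R) whose underlying set is (in bijection with) A. *)
Definition abelian_alg : Prop :=
  exists (R : nzRingType) (M : lmodType R) (h : A -> M),
    bijective h /\
    forall f, exists (r : 'I_(ar f) -> R) (c : M),
      forall a : 'I_(ar f) -> A,
        h (@op f a) = (\sum_(i < ar f) r i *: h (a i) + c)%R.

Definition is_idempotent (e : A) : Prop :=
  forall f, @op f (fun _ => e) = e.

Definition is_aut (g : A -> A) : Prop :=
  bijective g /\ forall f (a : 'I_(ar f) -> A), g (@op f a) = @op f (fun i => g (a i)).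
End Algebra.

(* Cantor space 2^omega = nat -> bool with the product topology.  A map     *)
(* g : 2^omega -> A into a discrete space is continuous iff it is locally   *)
(* constant on basic cylinders {z | z k = y k for k < N}.                   *)

Definition cantor := nat -> bool.

Section BooleanPower.
Variable A : Type.

Definition loc_const (g : cantor -> A) (y : cantor) (N : nat) : Prop :=
  forall z : cantor, (forall k, k < N -> z k = y k) -> g z = g y.

Definition cantor_continuous (g : cantor -> A) : Prop :=
  forall y : cantor, exists N, loc_const g y N.

Variables (n : nat) (x : 'I_n -> cantor) (e : 'I_n -> A).

Definition in_fbp (g : cantor -> A) : Prop :=
  cantor_continuous g /\ forall i, g (x i) = e i.

(* carrier of the filtered Boolean power (A^B)^x_e, B countable atomless *)
Definition fbp := {g : cantor -> A | in_fbp g}.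

Lemma loc_const_mono g y N M : N <= M -> loc_const g y N -> loc_const g y M.
Proof.
move=> NM H z Hz; apply: H => k kN; apply: Hz; exact: leq_trans kN NM.
Qed.

Lemma fin_loc_const (I : finType) (a : I -> cantor -> A) (y : cantor) :
  (forall i, exists N, loc_const (a i) y N) ->
  exists N, forall i, loc_const (a i) y N.
Proof.
move=> H.
suff [N HN] : exists N, forall i, i \in enum I -> loc_const (a i) y N.
  by exists N => i; apply: HN; rewrite mem_enum.
elim: (enum I) => [|j s [N2 IH]]; first by exists 0.
have [N1 H1] := H j.
exists (maxn N1 N2) => i; rewrite in_cons => /orP [/eqP -> | iin].
  exact: loc_const_mono (leq_maxl _ _) H1.
exact: loc_const_mono (leq_maxr _ _) (IH _ iin).
Qed.

Variables (F : Type) (ar : F -> nat) (op : forall f : F, ('I_(ar f) -> A) -> A).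
Hypothesis He : forall i, is_idempotent op (e i).

Lemma fbp_closed f (a : 'I_(ar f) -> fbp) :
  in_fbp (fun y => @op f (fun i => sval (a i) y)).
Proof.
split.
  move=> y.
  have [N HN] := @fin_loc_const _ (fun i => sval (a i)) y
                   (fun i => proj1 (proj2_sig (a i)) y).
  exists N => z Hz; congr (@op f _); apply: functional_extensionality => i.
  exact: HN.
move=> k.
have -> : (fun i => sval (a i) (x k)) = (fun _ => e k).
  by apply: functional_extensionality => i; exact: (proj2 (proj2_sig (a i))).
exact: He.
Qed.

Definition fbp_op f (a : 'I_(ar f) -> fbp) : fbp :=
  exist _ _ (fbp_closed a).
End BooleanPower.

(* Topology of pointwise convergence on a group G of permutations of a set  *)
(* S (given by a predicate Gp), its finite powers G^n (product topology),   *)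
(* comeagre sets, generic tuples and ample generics.                        *)

Section Generics.
Variables (S : Type) (Gp : (S -> S) -> Prop).

Definition in_Gn n (h : 'I_n -> S -> S) : Prop := forall j, Gp (h j).

Definition agree_on n (Fs : seq S) (h k : 'I_n -> S -> S) : Prop :=
  forall j s, List.In s Fs -> h j s = k j s.

Definition open_in n (O : ('I_n -> S -> S) -> Prop) : Prop :=
  forall h, in_Gn h -> O h ->
    exists Fs : seq S, forall k, in_Gn k -> agree_on Fs h k -> O k.

Definition dense_in n (O : ('I_n -> S -> S) -> Prop) : Prop :=
  forall h (Fs : seq S), in_Gn h ->
    exists k, [/\ in_Gn k, agree_on Fs h k & O k].

Definition comeagre_in n (C : ('I_n -> S -> S) -> Prop) : Prop :=
  exists O : nat -> ('I_n -> S -> S) -> Prop,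
    (forall m, open_in (O m) /\ dense_in (O m)) /\
    (forall h, in_Gn h -> (forall m, O m h) -> C h).

(* orbit of h under diagonal conjugation: k_j = g^-1 h_j g for some g in G,
   written without inverses as  g o k_j = h_j o g  (pointwise). *)
Definition conj_orbit n (h : 'I_n -> S -> S) (k : 'I_n -> S -> S) : Prop :=
  exists g, Gp g /\ forall j s, g (k j s) = h j (g s).

Definition generic n (h : 'I_n -> S -> S) : Prop :=
  in_Gn h /\ comeagre_in (conj_orbit h).

Definition ample_generics : Prop :=
  forall n, exists h : 'I_n -> S -> S, generic h.
End Generics.

(* Main.v *)
From HB Require Import structures.
Require Import Defs.
From mathcomp Require Import all_boot all_order all_algebra all_fingroup.
From mathcomp Require Import boolp.

(** Let H = Aut(A).  A surjective homomorphism from the filtered Boolean power S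
    to A is an evaluation at a point followed by an element of H: if it depended
    on the values on both sides of a clopen partition, the Mal'cev operation
    would commute with all operations of A and A would be abelian.  Hence an
    automorphism of S is given by a map f of the Cantor space and an H-valued
    cocycle b, as s |-> (y |-> s (f y) . b y), and it acts on all continuous maps
    P from the Cantor space to finite H-sets V with prescribed values at the x_i.
    A tuple h of automorphisms and such a map P define a finite graph on V whose
    j-edges are the pairs (P y, (h_j P) y) and their H-translates; prescribing
    these graphs is the same as prescribing an open set of tuples.

    Generic tuples are obtained from amalgamation of finite graphs.  Amalgamation
    holds over a graph in which every vertex has at most one label along which
    the outgoing edge is not unique, and such that following any other label one
    can only come back by a non-unique one.  Such graphs are cofinal: each graph
    has a cover whose vertices remember the label t by which they were entered;
    all other labels lead to a chosen neighbour, and backwards along t one may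
    either undo such a step or cross an arbitrary edge of the original graph.
    The elements of K (the H-orbits of the e_i) become isolated fixed vertices.
    A back-and-forth argument then shows that all tuples satisfying the resulting
    countably many open dense conditions are conjugate. *)

Set Implicit Arguments.
Unset Strict Implicit.
Unset Printing Implicit Defensive.

(** * Modules over endomorphism rings *)

Section EndomorphismRing.
Import GRing.Theory.
Local Open Scope ring_scope.
Variable M : finZmodType.

Definition endo_pred (f : {ffun M -> M}) :=
  [forall a, forall b, f (a + b) == f a + f b].

(** Finite functions cut out by a boolean predicate: pointwise equal endomorphisms are then equal,
    and the choice structure required of a ring is inherited. *)
Record endo := Endo { endo_fun :> {ffun M -> M}; _ : endo_pred endo_fun }.
HB.instance Definition _ := [isSub for endo_fun].
HB.instance Definition _ := [Finite of endo by <:].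

Lemma endoD (f : endo) : {morph f : a b / a + b}.
Proof. by move=> a b; case: f => f /= /forallP/(_ a)/forallP/(_ b)/eqP. Qed.

Lemma endo_predP (f : M -> M) : {morph f : a b / a + b} -> endo_pred [ffun a => f a].
Proof. by move=> H; apply/forallP => a; apply/forallP => b; rewrite !ffunE H. Qed.

Definition mk_endo f (H : {morph f : a b / a + b}) : endo := Endo (endo_predP H).

Lemma mk_endoE f (H : {morph f : a b / a + b}) a : mk_endo H a = f a.
Proof. by rewrite ffunE. Qed.

Lemma endoP (f g : endo) : f =1 g -> f = g.
Proof. by move=> H; apply: val_inj; apply/ffunP. Qed.

Lemma zero_endoP : {morph (fun _ : M => 0 : M) : a b / a + b}.
Proof. by move=> a b; rewrite addr0. Qed.
Lemma add_endoP (f g : endo) : {morph (fun a => f a + g a) : a b / a + b}.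
Proof. by move=> a b; rewrite !endoD addrACA. Qed.
Lemma opp_endoP (f : endo) : {morph (fun a => - f a) : a b / a + b}.
Proof. by move=> a b; rewrite endoD opprD. Qed.
Lemma one_endoP : {morph (fun a : M => a) : a b / a + b}.
Proof. by []. Qed.
Lemma mul_endoP (f g : endo) : {morph (fun a => f (g a)) : a b / a + b}.
Proof. by move=> a b; rewrite !endoD. Qed.

Definition zero_endo := mk_endo zero_endoP.
Definition add_endo f g := mk_endo (add_endoP f g).
Definition opp_endo f := mk_endo (opp_endoP f).
Definition one_endo := mk_endo one_endoP.
Definition mul_endo f g := mk_endo (mul_endoP f g).

Lemma add_endoA : associative add_endo.
Proof. by move=> f g h; apply: endoP => a; rewrite !mk_endoE addrA. Qed.
Lemma add_endoC : commutative add_endo.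
Proof. by move=> f g; apply: endoP => a; rewrite !mk_endoE addrC. Qed.
Lemma add0_endo : left_id zero_endo add_endo.
Proof. by move=> f; apply: endoP => a; rewrite !mk_endoE add0r. Qed.
Lemma addN_endo : left_inverse zero_endo opp_endo add_endo.
Proof. by move=> f; apply: endoP => a; rewrite !mk_endoE addNr. Qed.

HB.instance Definition _ :=
  GRing.isZmodule.Build endo add_endoA add_endoC add0_endo addN_endo.

Lemma mul_endoA : associative mul_endo.
Proof. by move=> f g h; apply: endoP => a; rewrite !mk_endoE. Qed.
Lemma mul1_endo : left_id one_endo mul_endo.
Proof. by move=> f; apply: endoP => a; rewrite !mk_endoE. Qed.
Lemma mul_endo1 : right_id one_endo mul_endo.
Proof. by move=> f; apply: endoP => a; rewrite !mk_endoE. Qed.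
Lemma mul_endoDl : left_distributive mul_endo +%R.
Proof. by move=> f g h; apply: endoP => a; rewrite !mk_endoE. Qed.
Lemma mul_endoDr : right_distributive mul_endo +%R.
Proof. by move=> f g h; apply: endoP => a; rewrite !mk_endoE endoD. Qed.

HB.instance Definition _ :=
  GRing.Zmodule_isPzRing.Build endo mul_endoA mul1_endo mul_endo1 mul_endoDl mul_endoDr.

Hypothesis M_nontrivial : exists a b : M, a <> b.

Lemma one_endo_neq0 : (1 : endo) != 0.
Proof.
apply/eqP => H; have [a [b]] := M_nontrivial; apply.
have E (c : M) : c = 0 by have := mk_endoE one_endoP c; rewrite -[mk_endo _]/(1 : endo) H mk_endoE.
by rewrite (E a) (E b).
Qed.

HB.instance Definition _ := GRing.PzSemiRing_isNonZero.Build endo one_endo_neq0.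

Definition endo_mod : Type := M.
HB.instance Definition _ := GRing.Zmodule.on endo_mod.

Definition endo_scale (f : endo) (a : endo_mod) : endo_mod := f a.

Lemma endo_scaleA f g a : endo_scale f (endo_scale g a) = endo_scale (f * g) a.
Proof. by rewrite /endo_scale mk_endoE. Qed.
Lemma endo_scale1 : left_id 1 endo_scale.
Proof. by move=> a; rewrite /endo_scale mk_endoE. Qed.
Lemma endo_scaleDr : right_distributive endo_scale +%R.
Proof. by move=> f a b; rewrite /endo_scale endoD. Qed.
Lemma endo_scaleDl a : {morph endo_scale^~ a : f g / f + g}.
Proof. by move=> f g; rewrite /endo_scale mk_endoE. Qed.

HB.instance Definition _ := GRing.Zmodule_isLmodule.Build endo endo_mod
  endo_scaleA endo_scale1 endo_scaleDr endo_scaleDl.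

(** [abelian_alg] leaves the choice of ring free. Over the full endomorphism ring every additive map
    is a scalar, so operations that are sums of additive maps plus a constant are affine. *)
Lemma abelian_of_affine (F : Type) (ar : F -> nat) (A : Type)
    (op : forall f : F, ('I_(ar f) -> A) -> A) (h : A -> M) :
  bijective h ->
  (forall f, exists (r : 'I_(ar f) -> endo) (c : M),
     forall a, h (@op f a) = \sum_(i < ar f) r i (h (a i)) + c) ->
  abelian_alg op.
Proof. by move=> hb H; exists endo, endo_mod, h. Qed.
End EndomorphismRing.

(** * Homomorphisms from products onto simple Mal'cev algebras *)

Lemma additive_decomp (M : zmodType) (I : finType) (G : (I -> M) -> M) :
  (forall a b, G (fun i => (a i + b i)%R) = (G a + G b)%R) ->
  forall a, G a = (\sum_i G (fun k => if k == i then a i else 0))%R.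
Proof.
move=> GD a.
have G0 : G (fun _ => 0%R) = 0%R.
  apply: (GRing.addrI (G (fun _ => 0%R))); rewrite -GD [RHS]GRing.addr0; congr G.
  by apply: funext => i; rewrite GRing.addr0.
have H (s : seq I) : G (fun k => \sum_(i <- s) (if k == i then a i else 0))%R =
    (\sum_(i <- s) G (fun k => if k == i then a i else 0))%R.
  elim: s => [|i s IH].
    by rewrite big_nil -[RHS]G0; congr G; apply: funext => k; rewrite big_nil.
  rewrite big_cons -IH -GD; congr G; apply: funext => k; by rewrite big_cons.
rewrite -H; congr G; apply: funext => k.
by rewrite -big_mkcond /= (big_pred1 k) // => i; rewrite /= eq_sym.
Qed.

Section TermOperations.
Variables (F : Type) (ar : F -> nat) (V : Type).

Lemma term_eval_compatible (A : Type) (op : forall f : F, ('I_(ar f) -> A) -> A)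
    (R : A -> A -> Prop) (t : term ar V) (v w : V -> A) :
  compatible op R -> (forall i, R (v i) (w i)) ->
  R (term_eval op v t) (term_eval op w t).
Proof. by move=> Rc vw; elim: t => //= f args IH; apply: Rc. Qed.

Lemma term_eval_hom2 (A C D : Type) (op : forall f : F, ('I_(ar f) -> A) -> A)
    (opC : forall f : F, ('I_(ar f) -> C) -> C)
    (opD : forall f : F, ('I_(ar f) -> D) -> D) (th : C -> D -> A) :
  (forall f a b, th (@opC f a) (@opD f b) = @op f (fun i => th (a i) (b i))) ->
  forall (t : term ar V) v w,
  th (term_eval opC v t) (term_eval opD w t) = term_eval op (fun i => th (v i) (w i)) t.
Proof.
move=> thH t v w; elim: t => //= f args IH; rewrite thH; congr (@op f _).
exact: funext.
Qed.
End TermOperations.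

Lemma triple_map2 (A C D : Type) (th : C -> D -> A) c1 c2 c3 d1 d2 d3 :
  (fun i => th (triple c1 c2 c3 i) (triple d1 d2 d3 i)) =
  triple (th c1 d1) (th c2 d2) (th c3 d3).
Proof. by apply: funext => -[[|[|[|k]]] hk]. Qed.

Section Malcev.
Variables (F : Type) (ar : F -> nat) (A : finType).
Variables (op : forall f : F, ('I_(ar f) -> A) -> A) (t : term ar 'I_3).
Hypothesis tP : forall a b : A,
  term_eval op (triple a a b) t = b /\ term_eval op (triple b a a) t = b.
Let m a b c := term_eval op (triple a b c) t.

Let mll a b : m a a b = b. Proof. by case: (tP a b). Qed.
Let mrr a b : m b a a = b. Proof. by case: (tP a b). Qed.

(** The Mal'cev term applied to the pairs [(a, b)], [(b, b)], [(b, c)] yields [(a, c)]. *)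
Lemma reflexive_compatible_trans (R : A -> A -> Prop) :
  (forall a, R a a) -> compatible op R -> forall a b c, R a b -> R b c -> R a c.
Proof.
move=> Rr Rc a b c ab bc.
have := @term_eval_compatible _ _ _ _ op R t (triple a b b) (triple b b c) Rc.
rewrite -/(m a b b) -/(m b b c) mll mrr; apply.
by move=> -[[|[|[|k]]] hk].
Qed.

Section Commuting.
Hypothesis m_op : forall f (a b c : 'I_(ar f) -> A),
  @op f (fun i => m (a i) (b i) (c i)) = m (@op f a) (@op f b) (@op f c).
Hypothesis m_m : forall a1 a2 a3 b1 b2 b3 c1 c2 c3,
  m (m a1 a2 a3) (m b1 b2 b3) (m c1 c2 c3) = m (m a1 b1 c1) (m a2 b2 c2) (m a3 b3 c3).
Variables (o o' : A) (oo' : o <> o').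

Let add a b := m a o b.
Let opp a := m o a o.

(** [m_m] equates applying [m] to a 3 by 3 matrix by rows and by columns. This law, associativity
    and inverses each come from a matrix that the Mal'cev identities collapse. *)
Let msym a b c : m a b c = m c b a.
Proof. by have := m_m b b a b b b c b b; rewrite !(mll, mrr). Qed.

Let addA : associative add.
Proof. by move=> a b c; have := m_m a o o o o o b o c; rewrite !(mll, mrr) /add. Qed.

Let addC : commutative add.
Proof. by move=> a b; rewrite /add msym. Qed.

Let add0 : left_id o add.
Proof. by move=> a; rewrite /add mll. Qed.

Let addN : left_inverse o opp add.
Proof.
move=> a; rewrite addC /add /opp.
by have := m_m a o o o o o o a o; rewrite !(mll, mrr).
Qed.

Let M : finZmodType := HB.pack_for finZmodType (Finite.sort A)
  (GRing.isZmodule.Build (Finite.sort A) addA addC add0 addN).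

Let mE (a b c : M) : m a b c = (a - b + c)%R.
Proof.
rewrite -[RHS]/(add (add a (opp b)) c) -addA.
have -> : m a b c = add a (m o b c).
  by have := m_m a o o o o b o o c; rewrite !(mll, mrr).
by congr (add a _); have := m_m o o o b o o o o c; rewrite !(mll, mrr).
Qed.

(** With [o] as zero, [m a b c] is a - b + c. An operation commuting with it becomes additive once
    its value at zero is subtracted, and then splits into endomorphisms of the coordinates. The
    element [o'] makes the endomorphism ring nonzero. *)
Lemma abelian_of_commuting_malcev : abelian_alg op.
Proof.
apply: (@abelian_of_affine M _ _ _ _ op (fun a => a)); first by exists o, o'.
  by exists (fun a => a).
move=> f; pose g0 (a : 'I_(ar f) -> M) : M := @op f a.
pose G a : M := (g0 a - g0 (fun _ => o))%R.
have GD a b : G (fun i => (a i + b i)%R) = (G a + G b)%R.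
  rewrite /G.
  have -> : g0 (fun i => (a i + b i)%R) = (g0 a - g0 (fun _ => o) + g0 b)%R.
    by rewrite -mE -m_op.
  by rewrite -!GRing.addrA.
pose g i (x : M) := G (fun k => if k == i then x else 0%R).
have gD i : {morph g i : a b / (a + b)%R}.
  move=> a b; rewrite /g -GD; congr G; apply: funext => k.
  by case: eqP => // _; rewrite GRing.addr0.
exists (fun i => mk_endo (gD i)), (g0 (fun _ => o)) => a.
have -> : @op f a = (G a + g0 (fun _ => o))%R by rewrite /G GRing.subrK.
rewrite (additive_decomp GD); congr (_ + _)%R.
by apply: eq_bigr => i _; rewrite mk_endoE.
Qed.
End Commuting.

Section Split.
Hypothesis (Hsimple : simple_alg op) (Hnonab : ~ abelian_alg op).
Variables (C : Type) (opC : forall f : F, ('I_(ar f) -> C) -> C).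
Hypothesis tC : forall a b : C,
  term_eval opC (triple a a b) t = b /\ term_eval opC (triple b a a) t = b.
Variable th : C -> C -> A.
Hypothesis thH : forall f a b,
  th (@opC f a) (@opC f b) = @op f (fun i => th (a i) (b i)).
Hypothesis th_onto : forall a, exists c d, th c d = a.

Let mC a b c := term_eval opC (triple a b c) t.
Let mCll a b : mC a a b = b. Proof. by case: (tC a b). Qed.
Let mCrr a b : mC b a a = b. Proof. by case: (tC a b). Qed.

Let thm c1 c2 c3 d1 d2 d3 :
  th (mC c1 c2 c3) (mC d1 d2 d3) = m (th c1 d1) (th c2 d2) (th c3 d3).
Proof. by rewrite /mC (term_eval_hom2 thH) triple_map2. Qed.

(** [R] is the image under [th] of the kernel of the first projection. It is a congruence by
    [reflexive_compatible_trans], so by simplicity it is equality or total. *)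
Let total1 : (forall c d d', th c d = th c d') \/ forall c a, exists d, th c d = a.
Proof.
pose R a b := exists c d d', a = th c d /\ b = th c d'.
have Rr a : R a a by have [c [d <-]] := th_onto a; exists c, d, d.
have Rc : compatible op R.
  move=> f a b H.
  have [c Hc] := choice H; have [d Hd] := choice Hc; have [d' Hd'] := choice Hd.
  exists (opC c), (opC d), (opC d'); rewrite !thH.
  by split; congr (@op f _); apply: funext => i; case: (Hd' i).
have RC : congruence op R.
  split=> //; first by move=> a b [c [d [d' [-> ->]]]]; exists c, d', d.
  exact: reflexive_compatible_trans.
case: (proj2 Hsimple R RC) => H; [left|right].
  by move=> c d d'; apply/H; exists c, d, d'.
move=> c0 a; have [c [d [d' [E1 E2]]]] := H (th c0 c0) a.
(* The witnesses live over some [c]; the Mal'cev term moves them over the given [c0]. *)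
by exists (mC c0 d d'); have := thm c0 c c c0 d d'; rewrite mCrr -E1 -E2 mll.
Qed.

Let total2 : (forall c c' d, th c d = th c' d) \/ forall d a, exists c, th c d = a.
Proof.
pose R a b := exists c c' d, a = th c d /\ b = th c' d.
have Rr a : R a a by have [c [d <-]] := th_onto a; exists c, c, d.
have Rc : compatible op R.
  move=> f a b H.
  have [c Hc] := choice H; have [d Hd] := choice Hc; have [d' Hd'] := choice Hd.
  exists (opC c), (opC d), (opC d'); rewrite !thH.
  by split; congr (@op f _); apply: funext => i; case: (Hd' i).
have RC : congruence op R.
  split=> //; first by move=> a b [c [c' [d [-> ->]]]]; exists c', c, d.
  exact: reflexive_compatible_trans.
case: (proj2 Hsimple R RC) => H; [left|right].
  by move=> c c' d; apply/H; exists c, c', d.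
move=> d0 a; have [c [c' [d [E1 E2]]]] := H (th d0 d0) a.
by exists (mC d0 c c'); have := thm d0 c c' d0 d d; rewrite mCrr -E1 -E2 mll.
Qed.

(* If [th] depended on both coordinates, then [m (th c a) (th c a') (th c'' a')]
   [= th c'' a] would make [m] commute with every operation. *)
Lemma factor_through_coordinate :
  (forall c d d', th c d = th c d') \/ (forall c c' d, th c d = th c' d).
Proof.
case: total1 => [|on1]; first by left.
case: total2 => [|on2]; first by right.
exfalso; apply: Hnonab.
(* Completing a parallelogram: once [a] and [b] share the first coordinate and [b] and [c] the
   second, the fourth corner has value [m a b c]. *)
have coords a b c : exists p q r s, [/\ th p q = a, th p r = b, th s r = c & th s q = m a b c].
  have [p [r pr]] := th_onto b; have [q pq] := on1 p a; have [s sr] := on2 r c.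
  exists p, q, r, s; split=> //.
  by rewrite -pr -pq -sr -thm mCll mCrr.
(* Both sides become [th (gC s) (gC q)]. The map [g] is arbitrary because it will be a basic
   operation and then [m] itself. *)
have key I (g : (I -> A) -> A) (gC : (I -> C) -> C) :
    (forall a b, th (gC a) (gC b) = g (fun i => th (a i) (b i))) ->
    forall a b c : I -> A, g (fun i => m (a i) (b i) (c i)) = m (g a) (g b) (g c).
  move=> gH a b c.
  have [p Hp] := choice (fun i => coords (a i) (b i) (c i)).
  have [q Hq] := choice Hp; have [r Hr] := choice Hq; have [s Hs] := choice Hr.
  have -> : a = fun i => th (p i) (q i) by apply: funext => i; case: (Hs i).
  have -> : b = fun i => th (p i) (r i) by apply: funext => i; case: (Hs i).
  have -> : c = fun i => th (s i) (r i) by apply: funext => i; case: (Hs i).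
  rewrite -!gH -thm mCll mCrr gH; congr g; apply: funext => i.
  by rewrite -thm mCll mCrr.
have [[o [o' oo']] _] := Hsimple.
apply: (@abelian_of_commuting_malcev _ _ o o' oo').
  by move=> f a b c; apply: (key _ (@op f) (@opC f)).
move=> a1 a2 a3 b1 b2 b3 c1 c2 c3.
have := key _ (fun v => term_eval op v t) (fun v => term_eval opC v t)
  (fun v w => term_eval_hom2 thH t v w) (triple a1 a2 a3) (triple b1 b2 b3) (triple c1 c2 c3).
rewrite -!/(m _ _ _) => <-; rewrite {1}/m; congr (term_eval op _ t).
by apply: funext => -[[|[|[|k]]] hk].
Qed.
End Split.
End Malcev.

(** * Clopen sets of the Cantor space *)

Definition bits N (y : cantor) : {ffun 'I_N -> bool} := [ffun i : 'I_N => y i].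

Definition bits_ext N (u : {ffun 'I_N -> bool}) : cantor :=
  fun k => if insub k is Some i then u i else false.

Definition level T N (P : cantor -> T) := forall y z, bits N y = bits N z -> P y = P z.

Lemma bitsP N y z : bits N y = bits N z <-> forall k, k < N -> y k = z k.
Proof.
split=> [/ffunP H k kN|H]; first by have := H (Ordinal kN); rewrite !ffunE.
by apply/ffunP => i; rewrite !ffunE H.
Qed.

Lemma bits_mono N M y z : N <= M -> bits M y = bits M z -> bits N y = bits N z.
Proof. by move=> NM /bitsP H; apply/bitsP => k kN; apply: H; apply: leq_trans NM. Qed.

Lemma bits_extK N u : bits N (bits_ext u) = u.
Proof. by apply/ffunP => i; rewrite ffunE /bits_ext valK. Qed.

Lemma level_mono T N M (P : cantor -> T) : N <= M -> level N P -> level M P.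
Proof. by move=> NM H y z /(bits_mono NM)/H. Qed.

Lemma level_ext T N (P : cantor -> T) y : level N P -> P (bits_ext (bits N y)) = P y.
Proof. by apply; rewrite bits_extK. Qed.

Lemma level_continuous T N (P : cantor -> T) : level N P -> cantor_continuous P.
Proof. by move=> H y; exists N => z Hz; apply: H; apply/bitsP. Qed.

(** Compactness, by Koenig's argument: [bad y k] says that no level suffices on the cylinder of
    length [k] around [y]. Badness passes to one of the two halves, and the resulting branch
    contradicts continuity at its limit. *)
Lemma continuous_level T (P : cantor -> T) : cantor_continuous P -> exists N, level N P.
Proof.
move=> cP; apply: contrapT => noN.
pose bad (y : cantor) k := forall N, exists z1 z2,
  [/\ bits k z1 = bits k y, bits k z2 = bits k y, bits N z1 = bits N z2 & P z1 <> P z2].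
pose upd (y : cantor) k b : cantor := fun i => if i == k then b else y i.
have step y k : bad y k -> exists b, bad (upd y k b) k.+1.
  move=> Hb; apply: contrapT => H.
  have fin b : exists N, forall z1 z2, bits k.+1 z1 = bits k.+1 (upd y k b) ->
      bits k.+1 z2 = bits k.+1 (upd y k b) -> bits N z1 = bits N z2 -> P z1 = P z2.
    apply: contrapT => H1; apply: H; exists b => N; apply: contrapT => H2; apply: H1.
    by exists N => z1 z2 E1 E2 E3; apply: contrapT => E4; apply: H2; exists z1, z2.
  have [N0 H0] := fin false; have [N1 H1] := fin true.
  have [z1 [z2 [E1 E2 E3 E4]]] := Hb (maxn k.+1 (maxn N0 N1)); apply: E4.
  have Ek : z1 k = z2 k by move/bitsP: E3; apply; rewrite leq_max ltnSn.
  have ext z : bits k z = bits k y -> bits k.+1 z = bits k.+1 (upd y k (z k)).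
    move/bitsP => E; apply/bitsP => i; rewrite ltnS leq_eqVlt /upd.
    by case: eqP => [->|_] //= ik; apply: E.
  case Ez : (z1 k).
    by apply: H1; rewrite -?Ez; [|rewrite Ek|]; try exact: ext;
       apply: bits_mono E3; rewrite !leq_max leqnn !orbT.
  by apply: H0; rewrite -?Ez; [|rewrite Ek|]; try exact: ext;
     apply: bits_mono E3; rewrite !leq_max leqnn !orbT.
have step' (yk : cantor * nat) :
    exists b, bad yk.1 yk.2 -> bad (upd yk.1 yk.2 b) yk.2.+1.
  have [/step [b Hb]|H] := pselect (bad yk.1 yk.2); first by exists b.
  by exists true.
have [nxt Hn] := choice step'.
pose br := fix br k : cantor :=
  if k is k'.+1 then upd (br k') k' (nxt (br k', k')) else fun _ => false.
have Hbr k : bad (br k) k.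
  elim: k => [|k IH]; last by apply: (Hn (br k, k)).
  move=> N; apply: contrapT => H; apply: noN; exists N => z1 z2 E.
  by apply: contrapT => E'; apply: H; exists z1, z2; split=> //; apply/bitsP.
pose y : cantor := fun k => br k.+1 k.
have Hy k : bits k (br k) = bits k y.
  apply/bitsP => i; elim: k => [|k IH] //; rewrite ltnS leq_eqVlt.
  case: eqP => [-> //|/eqP ik] /= /IH <-; by rewrite /upd (negPf ik).
have [N HN] := cP y; have [z1 [z2 [E1 E2 _]]] := Hbr N N; apply.
by rewrite (HN z1) ?(HN z2) //; apply/bitsP; rewrite -Hy.
Qed.

Lemma continuous_comp T T' (g : T -> T') (P : cantor -> T) :
  cantor_continuous P -> cantor_continuous (fun y => g (P y)).
Proof. by move=> cP y; have [N H] := cP y; exists N => z /H ->. Qed.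

Lemma continuous_glue T T' (P : cantor -> T) (c : T -> cantor -> T') :
  cantor_continuous P -> (forall t, cantor_continuous (c t)) ->
  cantor_continuous (fun y => c (P y) y).
Proof.
move=> cP cc y; have [N HN] := cP y; have [M HM] := cc (P y) y.
exists (maxn N M) => z Hz.
by rewrite (loc_const_mono (leq_maxl N M) HN Hz) (loc_const_mono (leq_maxr N M) HM Hz).
Qed.

Lemma continuous_pair T T' (P : cantor -> T) (Q : cantor -> T') :
  cantor_continuous P -> cantor_continuous Q -> cantor_continuous (fun y => (P y, Q y)).
Proof.
move=> cP cQ; apply: (continuous_glue (c := fun t y => (t, Q y)) cP) => t.
exact: continuous_comp.
Qed.

Lemma continuous_cst T (t : T) : cantor_continuous (fun _ => t).
Proof. by move=> y; exists 0. Qed.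

Lemma continuous_bits N : cantor_continuous (@bits N).
Proof. exact: (@level_continuous _ N). Qed.

Lemma continuous_if T (b : cantor -> bool) (P Q : cantor -> T) :
  cantor_continuous b -> cantor_continuous P -> cantor_continuous Q ->
  cantor_continuous (fun y => if b y then P y else Q y).
Proof.
move=> cb cP cQ.
by apply: (continuous_glue (c := fun (t : bool) y => if t then P y else Q y)) => // -[].
Qed.

Definition continuous_map (f : cantor -> cantor) :=
  forall k, cantor_continuous (fun y => f y k).

Lemma continuous_precomp T (P : cantor -> T) f :
  continuous_map f -> cantor_continuous P -> cantor_continuous (fun y => P (f y)).
Proof.
move=> cf cP y; have [N HN] := cP (f y).
have [M HM] := @fin_loc_const _ 'I_N (fun i y => f y i) y (fun i => cf i y).
exists M => z Hz; apply: HN => k kN; exact: (HM (Ordinal kN)).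
Qed.

Lemma continuous_map_id : continuous_map id.
Proof. by move=> k y; exists k.+1 => z; apply. Qed.

Lemma continuous_map_comp f g :
  continuous_map f -> continuous_map g -> continuous_map (fun y => f (g y)).
Proof. by move=> cf cg k; exact: (continuous_precomp (P := fun y => f y k) cg (cf k)). Qed.

Lemma continuous_map_glue T (P : cantor -> T) (f : T -> cantor -> cantor) :
  cantor_continuous P -> (forall t, continuous_map (f t)) ->
  continuous_map (fun y => f (P y) y).
Proof. by move=> cP cf k; apply: (continuous_glue (c := fun t y => f t y k)) => // t; apply: cf. Qed.

Lemma continuous_map_if (b : cantor -> bool) f g :
  cantor_continuous b -> continuous_map f -> continuous_map g ->
  continuous_map (fun y => if b y then f y else g y).
Proof.
move=> cb cf cg.
by apply: (continuous_map_glue (f := fun (t : bool) y => if t then f y else g y)) => // -[].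
Qed.

(** * The Cantor space as a disjoint union of finitely many copies of itself *)

Section CantorCopies.
Definition ccons b (z : cantor) : cantor := fun k => if k is k'.+1 then z k' else b.
Definition ctail (y : cantor) : cantor := fun k => y k.+1.

(** There are [k + 1] copies: for [a < k], copy [a] consists of the points starting with [a] ones
    and a zero, and copy [k] of those starting with [k] ones. [crest] deletes this prefix and [cmk]
    restores it. *)
Fixpoint cidx k (y : cantor) : nat :=
  if k is k'.+1 then if y 0 then (cidx k' (ctail y)).+1 else 0 else 0.
Fixpoint crest k (y : cantor) : cantor :=
  if k is k'.+1 then if y 0 then crest k' (ctail y) else ctail y else y.
Fixpoint cmk k a (z : cantor) : cantor :=
  if k is k'.+1 then
    if a is a'.+1 then ccons true (cmk k' a' z) else ccons false z
  else z.

Lemma cidx_le k y : cidx k y <= k.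
Proof. by elim: k y => //= k IH y; case: ifP => // _; apply: IH. Qed.

Lemma ccons_tail y : ccons (y 0) (ctail y) = y.
Proof. by apply: funext => -[]. Qed.

Lemma cmkK k y : cmk k (cidx k y) (crest k y) = y.
Proof.
elim: k y => //= k IH y; case E: (y 0) => /=; rewrite ?IH -[RHS]ccons_tail E //.
Qed.

Lemma cidxK k a z : a <= k -> cidx k (cmk k a z) = a.
Proof. by elim: k a => [|k IH] [|a] //= ak; rewrite IH. Qed.

Lemma crestK k a z : a <= k -> crest k (cmk k a z) = z.
Proof. by elim: k a => [|k IH] [|a] //= ak; rewrite IH. Qed.

Lemma continuous_ctail : continuous_map ctail.
Proof. by move=> k; apply: continuous_map_id. Qed.

Lemma continuous_ccons b f : continuous_map f -> continuous_map (fun y => ccons b (f y)).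
Proof. by move=> cf [|k] /=; [apply: continuous_cst|apply: cf]. Qed.

Lemma continuous_cidx k : cantor_continuous (cidx k).
Proof.
elim: k => /= [|k IH]; first exact: continuous_cst.
apply: (continuous_if (b := fun y => y 0)); [exact: continuous_map_id| |exact: continuous_cst].
by apply: continuous_comp; apply: continuous_precomp continuous_ctail IH.
Qed.

Lemma continuous_crest k : continuous_map (crest k).
Proof.
elim: k => /= [|k IH]; first exact: continuous_map_id.
apply: (continuous_map_if (b := fun y => y 0)); [exact: continuous_map_id| |exact: continuous_ctail].
exact: continuous_map_comp IH continuous_ctail.
Qed.

Lemma continuous_cmk k a : continuous_map (cmk k a).
Proof.
elim: k a => /= [|k IH] a; first exact: continuous_map_id.
by case: a => [|a]; apply: continuous_ccons => //; apply: continuous_map_id.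
Qed.

Definition capp N (u z : cantor) : cantor := fun k => if k < N then u k else z (k - N).
Definition cdrop N (y : cantor) : cantor := fun k => y (N + k).

Lemma bits_capp N u z : bits N (capp N u z) = bits N u.
Proof. by apply/bitsP => k kN; rewrite /capp kN. Qed.

Lemma cdrop_capp N u z : cdrop N (capp N u z) = z.
Proof. by apply: funext => k; rewrite /cdrop /capp ltnNge leq_addr /= addKn. Qed.

Lemma capp_drop N u y : bits N u = bits N y -> capp N u (cdrop N y) = y.
Proof.
move/bitsP => H; apply: funext => k; rewrite /capp /cdrop; case: ltnP => [/H //|Nk].
by rewrite subnKC.
Qed.

Lemma continuous_cdrop N : continuous_map (cdrop N).
Proof. by move=> k; apply: continuous_map_id. Qed.

Lemma continuous_capp N u : continuous_map (capp N u).
Proof. by move=> k; rewrite /capp; case: (k < N); [apply: continuous_cst|apply: continuous_map_id]. Qed.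
End CantorCopies.

(** A nonempty clopen set is a union of finitely many cylinders, each a copy of the Cantor space;
    the whole space is cut into equally many copies and these are matched. *)
Lemma clopen_homeo (U : cantor -> bool) : cantor_continuous U -> (exists y, U y) ->
  exists f g : cantor -> cantor, [/\ continuous_map f, continuous_map g,
    forall y, U (f y), forall y, g (f y) = y & forall u, U u -> f (g u) = u].
Proof.
move=> cU [y0 Uy0]; have [N HN] := continuous_level cU.
pose ws := [seq u <- enum {ffun 'I_N -> bool} | U (bits_ext u)].
have Uws y : (bits N y \in ws) = U y.
  by rewrite mem_filter mem_enum andbT level_ext.
(* One less than the number of cylinders, since [cidx k] distinguishes [k + 1] copies. *)
pose k := (size ws).-1.
have sws : size ws = k.+1.
  by rewrite prednK // -has_predT; apply/hasP; exists (bits N y0); rewrite ?Uws.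
pose w a := bits_ext (nth (bits N y0) ws a).
pose f y := capp N (w (cidx k y)) (crest k y).
pose g y := cmk k (index (bits N y) ws) (cdrop N y).
have bf y : bits N (f y) = nth (bits N y0) ws (cidx k y).
  by rewrite bits_capp bits_extK.
exists f, g; split.
- apply: (continuous_map_glue (f := fun a y => capp N (w a) (crest k y)));
    first exact: continuous_cidx.
  move=> a; apply: continuous_map_comp (@continuous_capp _ _) (@continuous_crest _).
- apply: (continuous_map_glue (P := bits N) (f := fun b y => cmk k (index b ws) (cdrop N y)));
    first exact: continuous_bits.
  move=> a; apply: continuous_map_comp (@continuous_cmk _ _) (@continuous_cdrop _).
- by move=> y; rewrite -Uws bf mem_nth // sws ltnS cidx_le.
- move=> y; rewrite /g bf index_uniq ?cdrop_capp ?cmkK //.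
    by rewrite sws ltnS cidx_le.
  by rewrite filter_uniq // enum_uniq.
- move=> u Uu; have Hi : index (bits N u) ws <= k by rewrite -ltnS -sws index_mem Uws.
  rewrite /f /g cidxK // crestK // capp_drop //.
  by rewrite /w bits_extK nth_index // Uws.
Qed.

(** [U] is a copy of the Cantor space, which is cut into enough pieces for all colours. The
    colouring is continuous on the whole space, so that colourings of different cells can be
    glued. *)
Lemma clopen_split (T : eqType) (U : cantor -> bool) (ts : seq T) :
  cantor_continuous U -> (exists y, U y) -> ts != [::] ->
  exists c : cantor -> T, [/\ cantor_continuous c, forall y, c y \in ts &
    forall t, t \in ts -> exists2 y, U y & c y = t].
Proof.
move=> cU Une tsne; have [f [g [cf cg fU gf fg]]] := clopen_homeo cU Une.
case: ts tsne => // t0 ts _; pose k := size ts.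
exists (fun y => nth t0 (t0 :: ts) (cidx k (g y))); split.
- apply: continuous_comp; exact: continuous_precomp cg (@continuous_cidx _).
- by move=> y; apply: mem_nth; rewrite ltnS cidx_le.
- move=> t tin; exists (f (cmk k (index t (t0 :: ts)) (fun _ => false))) => //.
  by rewrite gf cidxK ?nth_index // -ltnS -/(size (t0 :: ts)) index_mem.
Qed.

(** * Amalgamation of labelled graphs *)

(** Used to pass from common walks of every finite length to a single pair of vertices that works
    for all lengths. *)
Lemma decreasing_pigeonhole (T : finType) (Q : nat -> T -> Prop) :
  (forall k t, Q k.+1 t -> Q k t) -> (forall k, exists t, Q k t) ->
  exists t, forall k, Q k t.
Proof.
move=> Qd Qe; apply: contrapT => H.
have Qle k k' t : k <= k' -> Q k' t -> Q k t.
  by move=> /subnK <-; elim: (k' - k) => // d IH /Qd.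
have bad t : exists k, ~ Q k t.
  by apply: contrapT => H'; apply: H; exists t => k; apply: contrapT => H''; apply: H'; exists k.
have [f Hf] := choice bad.
have [t Ht] := Qe (\max_t f t); apply: (Hf t).
by apply: Qle Ht; apply: leq_bigmax.
Qed.

Section Graphs.
Variables (gT : finGroupType) (K : finType) (kact : K -> gT -> K).
Hypothesis kact1 : forall c, kact c 1%g = c.
Hypothesis kactM : forall c a b, kact c (a * b)%g = kact (kact c a) b.

(* Finite quotients of the space of homomorphisms from the filtered Boolean power
   to A of the form "evaluate, then apply an automorphism"; [K] is the set of
   constant ones. *)
Record obj := Obj {
  car :> finType;
  oact : car -> gT -> car;
  oio : K -> car;
  oact1 : forall v, oact v 1%g = v;
  oactM : forall v a b, oact v (a * b)%g = oact (oact v a) b;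
  oactio : forall c b, oio (kact c b) = oact (oio c) b }.

Lemma oactK (V : obj) (v : V) b : oact (oact v b) b^-1%g = v.
Proof. by rewrite -oactM mulgV oact1. Qed.
Lemma oactKV (V : obj) (v : V) b : oact (oact v b^-1%g) b = v.
Proof. by rewrite -oactM mulVg oact1. Qed.

Definition morph (V V' : obj) (p : V -> V') :=
  (forall v b, p (oact v b) = oact (p v) b) /\ (forall c, p (oio V c) = oio V' c).

Lemma morph_comp (V1 V2 V3 : obj) (p : V1 -> V2) (q : V2 -> V3) :
  morph p -> morph q -> morph (fun v => q (p v)).
Proof. by move=> [p1 p2] [q1 q2]; split=> *; rewrite ?p1 ?q1 ?p2 ?q2. Qed.

Section Prod.
Variables V1 V2 : obj.
Definition pact (v : V1 * V2) b := (oact v.1 b, oact v.2 b).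
Lemma pact1 v : pact v 1%g = v.
Proof. by case: v => a b; rewrite /pact !oact1. Qed.
Lemma pactM v a b : pact v (a * b)%g = pact (pact v a) b.
Proof. by rewrite /pact !oactM. Qed.
Lemma pactio c b : (oio V1 (kact c b), oio V2 (kact c b)) = pact (oio V1 c, oio V2 c) b.
Proof. by rewrite !oactio. Qed.
Definition prod_obj : obj := Obj pact1 pactM pactio.
End Prod.

Lemma fst_morph (V1 V2 : obj) : @morph (prod_obj V1 V2) V1 fst.
Proof. by []. Qed.
Lemma snd_morph (V1 V2 : obj) : @morph (prod_obj V1 V2) V2 snd.
Proof. by []. Qed.

Section Free.
Variable W : finType.
Definition fact (v : K + W * gT) b : K + W * gT :=
  match v with inl c => inl (kact c b) | inr (w, a) => inr (w, a * b)%g end.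
Lemma fact1 v : fact v 1%g = v.
Proof. by case: v => [c|[w a]] /=; rewrite ?kact1 ?mulg1. Qed.
Lemma factM v a b : fact v (a * b)%g = fact (fact v a) b.
Proof. by case: v => [c|[w d]] /=; rewrite ?kactM ?mulgA. Qed.
Lemma factio c b : inl (kact c b) = fact (inl c) b.
Proof. by []. Qed.
(** Maps out of it are given by arbitrary values on [W] ([free_lift]). Restricting to such objects
    over ordinals leaves only countably many to consider. *)
Definition free_obj : obj := Obj fact1 factM factio.

Definition free_lift (V : obj) (f : W -> V) (v : free_obj) : V :=
  match v with inl c => oio V c | inr (w, a) => oact (f w) a end.
Lemma free_lift_morph (V : obj) (f : W -> V) : morph (free_lift f).
Proof. by split=> [[c|[w a]] b|c] //=; rewrite ?oactio ?oactM. Qed.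
End Free.

Section Relations.
Variable m : nat.
(* [(j, true)] is the j-th generator, [(j, false)] its inverse. *)
Definition letter := ('I_m * bool)%type.
Definition linv (s : letter) : letter := (s.1, ~~ s.2).
Lemma linvK : involutive linv.
Proof. by case=> j b; rewrite /linv /= negbK. Qed.

Definition lrel (V : Type) (R : 'I_m -> V -> V -> Prop) (s : letter) v w :=
  if s.2 then R s.1 v w else R s.1 w v.

Lemma lrelV (V : Type) (R : 'I_m -> V -> V -> Prop) s v w :
  lrel R (linv s) v w = lrel R s w v.
Proof. by case: s => j []. Qed.

Definition live (V : Type) (R : 'I_m -> V -> V -> Prop) v := forall s, exists w, lrel R s v w.

(* Vertices without edges are allowed; they are ignored throughout. *)
Record valid (V : obj) (R : 'I_m -> V -> V -> Prop) : Prop := Valid {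
  valid_inv : forall j v w b, R j v w -> R j (oact v b) (oact w b);
  valid_live : forall s v w, lrel R s v w -> live R v;
  valid_loop : forall j c, R j (oio V c) (oio V c) }.

Definition img (V V' : Type) (p : V -> V') (R : 'I_m -> V -> V -> Prop) :
    'I_m -> V' -> V' -> Prop :=
  fun j v w => exists v' w', [/\ R j v' w', p v' = v & p w' = w].

(* [inw v] is the only label along which an edge at [v] may fail to be unique.
   Seen as labellings of the Cayley tree of a free group, walks are determined
   outwards from any pair of adjacent vertices pointing at each other, and every
   walk is a limit of walks with such a centre; this makes walks liftable. *)
Definition good (V : obj) (R : 'I_m -> V -> V -> Prop) :=
  exists inw : V -> option letter,
  [/\ forall v b, inw (oact v b) = inw v,
      forall s v w w', lrel R s v w -> lrel R s v w' -> inw v <> Some s -> w = w' &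
      forall s v w, lrel R s v w -> inw v <> Some s -> inw w = None \/ inw w = Some (linv s)].

Lemma valid_lrel_inv (V : obj) (R : 'I_m -> V -> V -> Prop) s v w b :
  valid R -> lrel R s v w -> lrel R s (oact v b) (oact w b).
Proof. by move=> HR; rewrite /lrel; case: s => j [] /= /(valid_inv HR). Qed.

Lemma valid_live_r (V : obj) (R : 'I_m -> V -> V -> Prop) s v w :
  valid R -> lrel R s v w -> live R w.
Proof. by move=> HR; rewrite -lrelV; apply: valid_live. Qed.

Lemma live_inv (V : obj) (R : 'I_m -> V -> V -> Prop) v b :
  valid R -> live R v -> live R (oact v b).
Proof. by move=> HR H s; have [w Hw] := H s; exists (oact w b); apply: valid_lrel_inv. Qed.

Lemma img_lrel (V V' : Type) (p : V -> V') (R : 'I_m -> V -> V -> Prop) s v w :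
  lrel R s v w -> lrel (img p R) s (p v) (p w).
Proof. by rewrite /lrel; case: s => j [] /= H; [exists v, w|exists w, v]. Qed.

Lemma img_lift (V V' : Type) (p : V -> V') (R : 'I_m -> V -> V -> Prop) s v w :
  lrel (img p R) s v w -> exists v' w', [/\ lrel R s v' w', p v' = v & p w' = w].
Proof. by rewrite /lrel; case: s => j [] /= [v' [w' [H <- <-]]]; [exists v', w'|exists w', v']. Qed.

Lemma rel_ext (V : Type) (R R' : 'I_m -> V -> V -> Prop) :
  (forall j v w, R j v w <-> R' j v w) -> R = R'.
Proof. by move=> H; do 3 (apply: funext => ?); apply: propext. Qed.

Lemma good_iso (V V' : obj) (p : V -> V') (q : V' -> V) (R : 'I_m -> V -> V -> Prop) :
  morph q -> cancel p q -> good R -> good (img p R).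
Proof.
move=> [qM _] pq [inw [h1 h2 h3]]; exists (fun v => inw (q v)).
have lift s v w : lrel (img p R) s v w ->
    [/\ lrel R s (q v) (q w), p (q v) = v & p (q w) = w].
  by move=> H0; have [v' [w' [H <- <-]]] := img_lift H0; rewrite !pq.
split=> [v b|s v w w' /lift [H _ <-] /lift [H' _ <-] Hs|s v w /lift [H _ _]].
- by rewrite qM.
- by rewrite (h2 _ _ _ _ H H' Hs).
- exact: h3.
Qed.

(** * Amalgamation over a good graph *)

Section Amalgam.
Variables (V0 V1 V2 : obj) (p1 : V1 -> V0) (p2 : V2 -> V0).
Hypotheses (p1M : morph p1) (p2M : morph p2).
Variables (R1 : 'I_m -> V1 -> V1 -> Prop) (R2 : 'I_m -> V2 -> V2 -> Prop).
Hypotheses (R1v : valid R1) (R2v : valid R2).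
Variable inw : V0 -> option letter.

(* The pair has a common walk of length [k] following the labels [inw]. *)
Fixpoint ext_in k v1 v2 : Prop :=
  [/\ live R1 v1, live R2 v2, p1 v1 = p2 v2 &
    if k is k'.+1 then
      if inw (p1 v1) is Some s then
        exists w1 w2, [/\ lrel R1 s v1 w1, lrel R2 s v2 w2 & ext_in k' w1 w2]
      else True
    else True].

Lemma ext_in_base k v1 v2 :
  ext_in k v1 v2 -> [/\ live R1 v1, live R2 v2 & p1 v1 = p2 v2].
Proof. by case: k => [|k] []. Qed.

Lemma ext_in_mono k v1 v2 : ext_in k.+1 v1 v2 -> ext_in k v1 v2.
Proof.
elim: k v1 v2 => [|k IH] v1 v2 [l1 l2 e H]; split=> //.
by case: (inw _) H => // s [w1 [w2 [E1 E2 /IH H]]]; exists w1, w2.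
Qed.

Definition ext_all v1 v2 := forall k, ext_in k v1 v2.

Hypothesis R12 : img p1 R1 = img p2 R2.
Hypothesis inw_inv : forall v b, inw (oact v b) = inw v.
Hypothesis det : forall s v w w',
  lrel (img p1 R1) s v w -> lrel (img p1 R1) s v w' -> inw v <> Some s -> w = w'.
Hypothesis out : forall s v w, lrel (img p1 R1) s v w -> inw v <> Some s ->
  inw w = None \/ inw w = Some (linv s).

Lemma ext_in_inv k v1 v2 b : ext_in k v1 v2 -> ext_in k (oact v1 b) (oact v2 b).
Proof.
elim: k v1 v2 => [|k IH] v1 v2 [l1 l2 e H]; split; try exact: live_inv;
  rewrite ?(proj1 p1M) ?(proj1 p2M) ?e //.
rewrite inw_inv -e; case: (inw _) H => // s [w1 [w2 [E1 E2 /IH H]]].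
by exists (oact w1 b), (oact w2 b); split=> //; apply: valid_lrel_inv.
Qed.

(** Outward edges are unique below, so [w1] and [w2] again lie over one vertex. The label [inw]
    there is absent or leads back to [(v1, v2)], whose walk is prolonged by this step. *)
Lemma ext_out k s v1 v2 w1 w2 : ext_in k v1 v2 -> inw (p1 v1) <> Some s ->
  lrel R1 s v1 w1 -> lrel R2 s v2 w2 -> ext_in k.+1 w1 w2.
Proof.
move=> Hk Hs E1 E2; have [l1 l2 e] := ext_in_base Hk.
have I1 := img_lrel p1 E1; have I2 := img_lrel p2 E2.
rewrite -R12 -e in I2.
have ew := det I1 I2 Hs.
split=> //; [exact: valid_live_r E1|exact: valid_live_r E2|].
case: (out I1 Hs) => -> //; exists v1, v2; split=> //; by rewrite lrelV.
Qed.

(** Induction on [k]. A vertex gets a partner with a walk of length [k + 1] by applying the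
    induction hypothesis to an edge along its label [inw]; [ext_out] then carries the partner across
    any outward edge. *)
Lemma ext_edge k s v1 w1 : lrel R1 s v1 w1 ->
  exists v2 w2, [/\ lrel R2 s v2 w2, ext_in k v1 v2 & ext_in k w1 w2].
Proof.
elim: k s v1 w1 => [|k IH] s v1 w1 E1.
  have I1 := img_lrel p1 E1; rewrite R12 in I1.
  have [v2 [w2 [E2 e1 e2]]] := img_lift I1.
  by exists v2, w2; split=> //; split=> //;
    [exact: valid_live E1|exact: valid_live E2|exact: valid_live_r E1|exact: valid_live_r E2].
have l1 := valid_live R1v E1.
have outward s' v1' w1' : lrel R1 s' v1' w1' -> inw (p1 v1') <> Some s' ->
    exists v2 w2, [/\ lrel R2 s' v2 w2, ext_in k.+1 v1' v2 & ext_in k.+1 w1' w2].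
  move=> E Hs'; have l := valid_live R1v E.
  have [v2 Hv2] : exists v2, ext_in k.+1 v1' v2.
    case Et: (inw (p1 v1')) => [t|].
      have [u1 Eu1] := l t; have [v2 [u2 [Eu2 Hv Hu]]] := IH _ _ _ Eu1.
      exists v2; have [q1 q2 e] := ext_in_base Hv; split=> //.
      by rewrite Et; exists u1, u2.
    have [v2 [u2 [_ Hv _]]] := IH _ _ _ E.
    exists v2; have [q1 q2 e] := ext_in_base Hv; split=> //.
    by rewrite Et.
  have [_ l2 _] := ext_in_base Hv2; have [w2 E2] := l2 s'.
  exists v2, w2; split=> //.
  exact: ext_out (ext_in_mono Hv2) Hs' E E2.
have [Hs|Hs] := EM (inw (p1 v1) = Some s); last exact: outward.
(* If the endpoints point at each other, the edge itself is the first step of both walks; otherwise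
   it is outward when read from [w1]. *)
have [Hw|Hw] := EM (inw (p1 w1) = Some (linv s)).
  have [v2 [w2 [E2 Hv Hw2]]] := IH _ _ _ E1; exists v2, w2; split=> //.
    have [q1 q2 e] := ext_in_base Hv; split=> //; rewrite Hs.
    by exists w1, w2.
  have [q1 q2 e] := ext_in_base Hw2; split=> //; rewrite Hw.
  by exists v1, v2; rewrite !lrelV.
have [|w2 [v2 [E2 Hw2 Hv]]] := outward (linv s) w1 v1 _ Hw; first by rewrite lrelV.
by exists v2, w2; rewrite -lrelV.
Qed.

Lemma ext_all_edge s v1 w1 : lrel R1 s v1 w1 ->
  exists v2 w2, [/\ lrel R2 s v2 w2, ext_all v1 v2 & ext_all w1 w2].
Proof.
move=> E.
have [|k|[v2 w2] H] := @decreasing_pigeonhole (V2 * V2)%type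
   (fun k t => [/\ lrel R2 s t.1 t.2, ext_in k v1 t.1 & ext_in k w1 t.2]).
- by move=> k [v2 w2] /= [E2 /ext_in_mono Hv /ext_in_mono Hw].
- by have [v2 [w2 H]] := ext_edge k E; exists (v2, w2).
- by exists v2, w2; split=> [|k|k]; [case: (H 0)|case: (H k)|case: (H k)].
Qed.

Lemma ext_all_live v1 v2 s : ext_all v1 v2 ->
  exists w1 w2, [/\ lrel R1 s v1 w1, lrel R2 s v2 w2 & ext_all w1 w2].
Proof.
move=> H; have [l1 l2 e] := ext_in_base (H 0).
have [Hs|Hs] := EM (inw (p1 v1) = Some s).
  have [|k|[w1 w2] Hw] := @decreasing_pigeonhole (V1 * V2)%type
   (fun k t => [/\ lrel R1 s v1 t.1, lrel R2 s v2 t.2 & ext_in k t.1 t.2]).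
  - by move=> k [w1 w2] /= [E1 E2 /ext_in_mono Hw].
  - have [_ _ _] := H k.+1; rewrite Hs => -[w1 [w2 Hw]]; by exists (w1, w2).
  - by exists w1, w2; split=> [||k]; [case: (Hw 0)|case: (Hw 0)|case: (Hw k)].
have [w1 E1] := l1 s; have [w2 E2] := l2 s; exists w1, w2; split=> // k.
by apply: ext_in_mono; apply: ext_out (H k) Hs E1 E2.
Qed.
End Amalgam.

Lemma ext_in_sym (V0 V1 V2 : obj) (p1 : V1 -> V0) (p2 : V2 -> V0) R1 R2 inw k v1 v2 :
  ext_in p1 p2 R1 R2 inw k v1 v2 -> ext_in p2 p1 R2 R1 inw k v2 v1.
Proof.
elim: k v1 v2 => [|k IH] v1 v2 [l1 l2 e H]; split=> //; rewrite -e.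
by case: (inw _) H => // s [w1 [w2 [E1 E2 /IH H]]]; exists w2, w1.
Qed.

(** The full fibre product of the edges may have dead ends. Keeping only pairs of vertices with
    common walks of every length removes these, and [ext_all_edge] shows that every edge of either
    factor survives. *)
Lemma amalgamation (V0 V1 V2 : obj) (p1 : V1 -> V0) (p2 : V2 -> V0)
    (R1 : 'I_m -> V1 -> V1 -> Prop) (R2 : 'I_m -> V2 -> V2 -> Prop) :
  morph p1 -> morph p2 -> valid R1 -> valid R2 -> img p1 R1 = img p2 R2 ->
  good (img p1 R1) ->
  exists R3 : 'I_m -> prod_obj V1 V2 -> prod_obj V1 V2 -> Prop,
  [/\ valid R3, img fst R3 = R1, img snd R3 = R2 &
      forall s v w, lrel R3 s v w -> p1 v.1 = p2 v.2].
Proof.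
move=> p1M p2M R1v R2v R12 [inw [inwI det out]].
pose E := ext_all p1 p2 R1 R2 inw.
pose R3 j (v w : prod_obj V1 V2) :=
  [/\ R1 j v.1 w.1, R2 j v.2 w.2, E v.1 v.2 & E w.1 w.2].
have lR3 s v w : lrel R3 s v w <-> [/\ lrel R1 s v.1 w.1, lrel R2 s v.2 w.2, E v.1 v.2 & E w.1 w.2].
  by rewrite /lrel; case: s => j [] /=; split=> -[].
have edge1 := ext_all_edge R1v R2v R12 det out.
have edge2 s v2 w2 : lrel R2 s v2 w2 ->
    exists v1 w1, [/\ lrel R1 s v1 w1, E v1 v2 & E w1 w2].
  move=> H; rewrite R12 in det out.
  have [v1 [w1 [H1 Hv Hw]]] := ext_all_edge R2v R1v (esym R12) det out H.
  by exists v1, w1; split=> // k; apply: ext_in_sym.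
(* Elements of [K] carry loops for all labels, so constant walks serve. *)
have Eio c : E (oio V1 c) (oio V2 c).
  have loop (V' : obj) (R' : 'I_m -> V' -> V' -> Prop) s :
      valid R' -> lrel R' s (oio V' c) (oio V' c).
    by move=> Rv; rewrite /lrel; case: ifP => _; apply: valid_loop.
  have l (V' : obj) (R' : 'I_m -> V' -> V' -> Prop) : valid R' -> live R' (oio V' c).
    by move=> Rv s; exists (oio V' c); apply: loop.
  elim=> [|k IH]; split=> //; rewrite ?(proj2 p1M) ?(proj2 p2M) //; try exact: l.
  by case: (inw _) => // s; exists (oio V1 c), (oio V2 c); split=> //; apply: loop.
exists R3; split.
- split.
  + move=> j v w b [H1 H2 H3 H4]; split; [exact: valid_inv|exact: valid_inv| |];
    by move=> k; apply: ext_in_inv.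
  + move=> s v w /lR3 [_ _ Hv _] s'.
    have [w1 [w2 [H1 H2 H3]]] := ext_all_live R1v R2v R12 det out s' Hv.
    by exists (w1, w2); apply/lR3.
  + by move=> j c; split=> /=; [exact: valid_loop|exact: valid_loop|exact: Eio|exact: Eio].
- apply: rel_ext => j v w; split; first by move=> [v' [w' [[H _ _ _] <- <-]]].
  move=> H; have [v2 [w2 [H2 Hv Hw]]] := edge1 (j, true) v w H.
  by exists (v, v2), (w, w2).
- apply: rel_ext => j v w; split; first by move=> [v' [w' [[_ H _ _] <- <-]]].
  move=> H; have [v1 [w1 [H1 Hv Hw]]] := edge2 (j, true) v w H.
  by exists (v1, v), (w1, w).
- by move=> s v w /lR3 [_ _ /(_ 0) []].
Qed.

(** * Good covers of arbitrary valid graphs *)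

Section Cover.
Variables (V : obj) (R : 'I_m -> V -> V -> Prop).
Hypothesis Rv : valid R.
Variable dl : V -> letter -> V.
Hypothesis dlP : forall v s, live R v -> lrel R s v (dl v s).

Definition cover_obj := free_obj (V * letter)%type.
(* The vertex [inr ((v, t), a)] stands for [oact v a], entered along the label [t]. *)
Definition cover_proj : cover_obj -> V := free_lift (fun vt : V * letter => vt.1).

Definition outward (s : letter) (vt wr : V * letter) :=
  [/\ live R vt.1, s <> linv vt.2 & wr = (dl vt.1 s, s)].

(** The three kinds of edges are a step to the chosen neighbour, its reverse, and an edge of [R]
    between two vertices pointing at each other; the last kind makes the cover map onto [R]. The
    group coordinate never changes. *)
Definition cover_lrel s (x y : cover_obj) : Prop :=
  match x, y with
  | inl c, inl d => c = d
  | inr (vt, a), inr (wr, b) => a = b /\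
     [\/ outward s vt wr, outward (linv s) wr vt |
         [/\ vt.2 = linv s, wr.2 = s & lrel R s vt.1 wr.1]]
  | _, _ => False
  end.

Definition cover_rel j := cover_lrel (j, true).

Lemma cover_lrelV s x y : cover_lrel (linv s) x y = cover_lrel s y x.
Proof.
case: x y => [c|[vt a]] [d|[wr b]] //=; apply: propext; split; try by move=> ->.
- move=> [-> H]; split=> //; rewrite linvK lrelV in H.
  by case: H => [H|H|[E1 E2 E3]]; [apply: Or32|apply: Or31|apply: Or33].
- move=> [-> H]; split=> //; rewrite linvK lrelV.
  by case: H => [H|H|[E1 E2 E3]]; [apply: Or32|apply: Or31|apply: Or33].
Qed.

Lemma cover_relE s x y : lrel cover_rel s x y = cover_lrel s x y.
Proof.
case: s => j [] //=; by rewrite /lrel /cover_rel /= -cover_lrelV.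
Qed.

Lemma cover_proj_lrel s x y : cover_lrel s x y -> lrel R s (cover_proj x) (cover_proj y).
Proof.
case: x y => [c|[[v t] a]] [d|[[w r] b]] //=.
  by move=> ->; rewrite /lrel; case: ifP => _; apply: valid_loop.
move=> [-> [[/= l _ [-> _]]|[/= l _ [-> _]]|[/= _ _ H]]]; apply: valid_lrel_inv => //.
- exact: dlP.
- by rewrite -lrelV; apply: dlP.
Qed.

Lemma cover_valid : valid cover_rel.
Proof.
split.
- move=> j [c|[[v t] a]] [d|[[w r] b]] g //=; rewrite /cover_rel /=.
    by move=> ->.
  by move=> [-> H].
- move=> s x y; rewrite cover_relE => H s'.
  case: x y H => [c|[[v t] a]] [d|[[w r] b]] //= H.
    by exists (inl c); rewrite cover_relE.
  have l : live R v.
    case: H => _ [[/= l _ _] //|[/= l _ [-> _]]|[/= _ _ H]].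
      exact: valid_live_r Rv (dlP _ l).
    exact: valid_live H.
  (* Only the label leading back admits no outward step; along it an edge of the third kind
     exists. *)
  have [E|E] := eqVneq s' (linv t).
    exists (inr (dl v s', s', a)); rewrite cover_relE /=; split=> //.
    by apply: Or33; split; rewrite //= ?E ?linvK //; apply: dlP.
  exists (inr (dl v s', s', a)); rewrite cover_relE /=; split=> //.
  by apply: Or31; split=> //=; apply/eqP.
- by [].
Qed.

Lemma cover_good : good cover_rel.
Proof.
exists (fun x : cover_obj => if x is inr (vt, a) then Some (linv vt.2) else None); split.
- by move=> [c|[[v t] a]] b.
- move=> s x y y'; rewrite !cover_relE.
  case: x y y' => [c|[[v t] a]] [d|[[w r] b]] [d'|[[w' r'] b']] //=.
    by move=> -> ->.
  have fix_out u q c : t <> linv s -> a = c /\ [\/ outward s (v, t) (u, q), outward (linv s) (u, q) (v, t) |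
      [/\ t = linv s, q = s & lrel R s v u]] -> (u, q, c) = (dl v s, s, a).
    by move=> ts [<-] [[/= _ _ [-> ->]]|[/= _ _ [_ tE]]|[/= tE]] //; case: ts.
  move=> H H' Hs; have ts : t <> linv s by move=> E; apply: Hs; rewrite E linvK.
  by congr inr; rewrite (fix_out _ _ _ ts H) (fix_out _ _ _ ts H').
- move=> s x y; rewrite cover_relE.
  case: x y => [c|[[v t] a]] [d|[[w r] b]] //=; first by left.
  move=> [_ H] Hs; right; have ts : t <> linv s by move=> E; apply: Hs; rewrite E linvK.
  by case: H => [[/= _ _ [_ ->]]|[/= _ _ [_ tE]]|[/= tE]] //; case: ts.
Qed.

Lemma cover_img : img cover_proj cover_rel = R.
Proof.
apply: rel_ext => j v w; split.
  move=> [x [y [H <- <-]]]; exact: (@cover_proj_lrel (j, true)).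
move=> H; exists (inr (v, (j, false), 1%g)), (inr (w, (j, true), 1%g)).
rewrite /= !oact1; split=> //; split=> //; exact: Or33.
Qed.
End Cover.

(** The last two clauses allow the cover to be mapped onto the equality relation on a single free
    orbit. *)
Lemma cover_exists (V : obj) (R : 'I_m -> V -> V -> Prop) : valid R ->
  exists R' : 'I_m -> free_obj (V * letter)%type -> free_obj (V * letter)%type -> Prop,
  [/\ valid R', good R', img (@cover_proj V) R' = R,
      forall j x y, R' j x y -> match x, y with
        | inl c, inl d => c = d | inr (_, a), inr (_, b) => a = b | _, _ => False end &
      forall j v w, R j v w -> exists x y, R' j (inr (x, 1%g)) (inr (y, 1%g))].
Proof.
move=> Rv.
(* Any choice of neighbours will do; [vs.1] is a default at vertices that are not live. *)
have H (vs : V * letter) : exists w, live R vs.1 -> lrel R vs.2 vs.1 w.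
  have [l|l] := pselect (live R vs.1); last by exists vs.1.
  by have [w Hw] := l vs.2; exists w.
have [dl0 Hdl] := choice H; pose dl v s := dl0 (v, s).
have dlP v s : live R v -> lrel R s v (dl v s) by apply: (Hdl (v, s)).
exists (cover_rel R dl); split.
- exact: cover_valid.
- exact: cover_good.
- exact: cover_img.
- by move=> j [c|[vt a]] [d|[wr b]] //= [].
- by move=> j v w Rvw; exists (v, (j, false)), (w, (j, true)); split=> //; apply: Or33.
Qed.

Definition triv_rel (W : finType) (j : 'I_m) (v w : free_obj W) := v = w.

Lemma triv_good W : good (triv_rel (W := W)).
Proof.
exists (fun _ => None); split=> //; last by left.
by move=> s v w w'; rewrite /lrel; case: ifP => _; rewrite /triv_rel => -> ->.
Qed.
End Relations.
End Graphs.

(** * Generic tuples *)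

Lemma In_mem (T : eqType) (t : T) s : t \in s -> List.In t s.
Proof.
by elim: s => //= u s IH; rewrite in_cons => /orP [/eqP ->|/IH]; [left|right].
Qed.

Lemma fbp_inj (A : Type) n (x : 'I_n -> cantor) (e : 'I_n -> A) (f g : fbp x e) :
  sval f = sval g -> f = g.
Proof.
by case: f g => [f pf] [g pg] /= E; subst g; congr exist; apply: Prop_irrelevance.
Qed.

Lemma separating_level n (x : 'I_n -> cantor) : injective x ->
  exists N, forall i k, bits N (x i) = bits N (x k) -> i = k.
Proof.
move=> xI.
have H (ik : 'I_n * 'I_n) : exists N, x ik.1 N = x ik.2 N -> ik.1 = ik.2.
  apply: contrapT => H; apply: (H); exists 0 => _; apply: xI; apply: funext => k.
  by apply: contrapT => E; apply: H; exists k.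
have [d Hd] := choice H; exists (\max_ik (d ik).+1) => i k /bitsP E.
apply: (Hd (i, k)); apply: E; exact: (leq_bigmax (F := fun ik => (d ik).+1) (i, k)).
Qed.

(** * The action of automorphisms on maps with prescribed values at the points [x i] *)

Section Filtered.
Variables (F : Type) (ar : F -> nat) (A : finType).
Variable (op : forall f : F, ('I_(ar f) -> A) -> A).
Variables (gT : finGroupType) (aact : A -> gT -> A).
Hypothesis aact1 : forall a, aact a 1%g = a.
Hypothesis aactM : forall a b c, aact a (b * c)%g = aact (aact a b) c.
Hypothesis aact_faithful : forall b c, (forall a, aact a b = aact a c) -> b = c.
Hypothesis aact_op : forall f (a : 'I_(ar f) -> A) b,
  aact (@op f a) b = @op f (fun i => aact (a i) b).
Hypothesis A_nontrivial : exists a b : A, a <> b.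
Variables (n : nat) (e : 'I_n -> A) (He : forall i, is_idempotent op (e i)).
Variables (x : 'I_n -> cantor) (Hx : injective x).

Notation S := (fbp x e).
Notation isaut := (is_aut (fbp_op (x := x) He)).

(** The pair is not unique: at [x i], the automorphism of [A] may be changed by one fixing [e i]. No
    continuity is demanded of it; it is the action on maps that will be continuous. *)
Definition rep (h : S -> S) (pb : (cantor -> cantor) * (cantor -> gT)) :=
  forall f y, sval (h f) y = aact (sval f (pb.1 y)) (pb.2 y).
Hypothesis rep_exists : forall h, isaut h -> exists pb, rep h pb.

Lemma aact_inj b : injective (aact^~ b).
Proof. by move=> a c /(congr1 (aact^~ b^-1%g)); rewrite -!aactM mulgV !aact1. Qed.

Definition idem_orbit (a : A) := [exists i, exists b, a == aact (e i) b].
Definition K : finType := {a : A | idem_orbit a}.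

Lemma kact_proof (c : K) b : idem_orbit (aact (val c) b).
Proof.
case: c => a /= /existsP [i /existsP [d /eqP ->]].
by apply/existsP; exists i; apply/existsP; exists (d * b)%g; rewrite aactM.
Qed.
Definition kact (c : K) b : K := Sub (aact (val c) b) (kact_proof c b).
Lemma kact1 c : kact c 1%g = c.
Proof. by apply: val_inj; rewrite /= aact1. Qed.
Lemma kactM c a b : kact c (a * b)%g = kact (kact c a) b.
Proof. by apply: val_inj; rewrite /= aactM. Qed.

Lemma idemK_proof i : idem_orbit (e i).
Proof. by apply/existsP; exists i; apply/existsP; exists 1%g; rewrite aact1. Qed.
Definition idemK i : K := Sub (e i) (idemK_proof i).

Lemma K_generated (c : K) : exists i b, c = kact (idemK i) b.
Proof.
case: c => a Ha; have /existsP [i /existsP [b /eqP E]] := Ha.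
by exists i, b; apply: val_inj.
Qed.

Definition Aobj : obj kact := @Obj _ _ kact A aact val aact1 aactM (fun c b => erefl).

(* Levels at least [sep_level] separate the points [x i]. *)
Definition sep_level := sval (cid (separating_level Hx)).
Lemma sep_levelP N i k : sep_level <= N -> bits N (x i) = bits N (x k) -> i = k.
Proof. by move=> HN /(bits_mono HN); apply: (svalP (cid (separating_level Hx))). Qed.

Definition near N y := [pick i | bits N y == bits N (x i)].

Lemma nearP N y :
  (exists2 i, near N y = Some i & bits N y = bits N (x i)) \/
  (near N y = None /\ forall i, bits N y <> bits N (x i)).
Proof.
rewrite /near; case: pickP => [i /eqP E|H]; first by left; exists i.
by right; split=> // i /eqP; rewrite H.
Qed.

Lemma near_x N i : sep_level <= N -> near N (x i) = Some i.
Proof. by move=> HN; case: (nearP N (x i)) => [[k -> /(sep_levelP HN) ->]|[_ /(_ i)]]. Qed.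

Lemma near_level N : level N (near N).
Proof. by move=> y z E; rewrite /near E. Qed.

Definition filtered_map (V : obj kact) (P : cantor -> V) := in_fbp x (fun i => oio V (idemK i)) P.

Definition fix_near (V : obj kact) N (g : cantor -> V) y :=
  if near N y is Some i then oio V (idemK i) else g y.

Lemma fix_near_funs (V : obj kact) N (g : cantor -> V) :
  sep_level <= N -> cantor_continuous g -> filtered_map (fix_near N g).
Proof.
move=> HN cg; split; last by move=> i; rewrite /fix_near near_x.
apply: (continuous_glue (P := near N)
  (c := fun o y => if o is Some i then oio V (idemK i) else g y)).
  exact: level_continuous (@near_level N).
by case=> [i|] //; apply: continuous_cst.
Qed.

Lemma filtered_map_near (V : obj kact) N (P : cantor -> V) y i :
  filtered_map P -> level N P -> bits N y = bits N (x i) -> P y = oio V (idemK i).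
Proof. by move=> [_ Px] lP /lP ->. Qed.

Lemma filtered_map_level (V : obj kact) (P : cantor -> V) :
  filtered_map P -> exists2 N, sep_level <= N & level N P.
Proof.
move=> [/continuous_level [N HN] _]; exists (maxn sep_level N); rewrite ?leq_maxl //.
exact: level_mono (leq_maxr _ _) HN.
Qed.

(* This makes the action of an automorphism on maps into arbitrary finite H-sets
   well defined, continuous, and determined by finitely many values. *)
Lemma fbp_separates (V : obj kact) (P : cantor -> V) : filtered_map P ->
  exists Fs : seq S, forall y1 y2 b1 b2,
    (forall f, List.In f Fs -> aact (sval f y1) b1 = aact (sval f y2) b2) ->
    oact (P y1) b1 = oact (P y2) b2.
Proof.
move=> fP; have [N HN lP] := filtered_map_level fP; have [a0 [a1 a01]] := A_nontrivial.
(* Functions equal to [a] on one cylinder and to [a0] on the others. Away from the [x i] their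
   values determine the prefix of the point and, by faithfulness, the group element. *)
pose g (ua : {ffun 'I_N -> bool} * A) (y : cantor) : Aobj := if bits N y == ua.1 then ua.2 else a0.
have cg ua : cantor_continuous (g ua).
  by apply: (@level_continuous _ N) => y z E; rewrite /g E.
pose gs ua : S := exist _ _ (fix_near_funs HN (cg ua)).
exists (map gs (enum {: {ffun 'I_N -> bool} * A})) => y1 y2 b1 b2 H.
have Hg ua : aact (fix_near N (g ua) y1) b1 = aact (fix_near N (g ua) y2) b2.
  by apply: (H (gs ua)); apply: List.in_map; apply: In_mem; rewrite mem_enum.
have gen z1 z2 c1 c2 : (forall ua, aact (fix_near N (g ua) z1) c1 = aact (fix_near N (g ua) z2) c2) ->
    near N z1 = None -> bits N z1 = bits N z2 /\ c1 = c2.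
  move=> Hz n1.
  have Ea a : aact a c1 = aact (fix_near N (g (bits N z1, a)) z2) c2.
    by rewrite -Hz /fix_near n1 /g /= eqxx.
  have [E|/eqP E] := eqVneq (bits N z1) (bits N z2).
    split=> //; apply: aact_faithful => a; rewrite Ea /fix_near -(near_level E) n1.
    by rewrite /g /= E eqxx.
  exfalso; apply: a01; apply: (@aact_inj c1); rewrite /= !Ea /fix_near /g /=.
  by rewrite (negPf (_ : bits N z2 != bits N z1)) // eq_sym; apply/eqP.
case: (nearP N y1) => [[i n1 E1]|[n1 _]]; last first.
  by have [E ->] := gen _ _ _ _ Hg n1; rewrite (lP _ _ E).
case: (nearP N y2) => [[k n2 E2]|[n2 _]]; last first.
  by have [E ->] := gen _ _ _ _ (fun ua => esym (Hg ua)) n2; rewrite (lP _ _ E).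
rewrite (filtered_map_near fP lP E1) (filtered_map_near fP lP E2) -!oactio; congr (oio V _).
by apply: val_inj; have := Hg ([ffun=> true], a0); rewrite /fix_near n1 n2.
Qed.

Definition rep_of (h : S -> S) : (cantor -> cantor) * (cantor -> gT) :=
  if pselect (exists pb, rep h pb) is left H then sval (cid H) else (id, fun _ => 1%g).

Lemma rep_ofP h : isaut h -> rep h (rep_of h).
Proof.
move=> /rep_exists H; rewrite /rep_of; case: pselect => [H'|//]; exact: (svalP (cid H')).
Qed.

Definition transport (V : obj kact) (h : S -> S) (P : cantor -> V) y :=
  oact (P ((rep_of h).1 y)) ((rep_of h).2 y).

Lemma transport_rep (V : obj kact) h pb (P : cantor -> V) y :
  isaut h -> rep h pb -> filtered_map P -> transport h P y = oact (P (pb.1 y)) (pb.2 y).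
Proof.
move=> hA hr fP; have [Fs HFs] := fbp_separates fP.
by apply: HFs => f _; rewrite -hr -(rep_ofP hA).
Qed.

Lemma transport_funs (V : obj kact) h (P : cantor -> V) : isaut h -> filtered_map P -> filtered_map (transport h P).
Proof.
move=> hA fP; have [Fs HFs] := fbp_separates fP.
have hr := rep_ofP hA.
split=> [y|i]; last first.
  rewrite -(proj2 fP) -[RHS]oact1; apply: HFs => f _.
  by rewrite -hr aact1 (proj2 (svalP (h f))) (proj2 (svalP f)).
have [N HN] : exists N, forall f, List.In f Fs -> loc_const (sval (h f)) y N.
  elim: (Fs) => [|f Gs [N IH]]; first by exists 0.
  have [M HM] := proj1 (svalP (h f)) y; exists (maxn N M) => g /= [<-|/IH Hg].
    exact: loc_const_mono (leq_maxr _ _) HM.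
  exact: loc_const_mono (leq_maxl _ _) Hg.
by exists N => z Hz; apply: HFs => f /HN/(_ z Hz); rewrite !hr.
Qed.

Lemma transport_determined (V : obj kact) (P : cantor -> V) : filtered_map P ->
  exists Fs : seq S, forall h k, isaut h -> isaut k ->
    (forall f, List.In f Fs -> h f = k f) -> transport h P = transport k P.
Proof.
move=> fP; have [Fs HFs] := fbp_separates fP; exists Fs => h k hA kA H.
by apply: funext => y; apply: HFs => f /H E; rewrite -(rep_ofP hA) -(rep_ofP kA) E.
Qed.

Lemma transport_morph (V V' : obj kact) h (p : V -> V') (P : cantor -> V) :
  morph p -> transport h (fun y => p (P y)) = fun y => p (transport h P y).
Proof. by move=> [pM _]; apply: funext => y; rewrite /transport pM. Qed.

Lemma transport_fbp h (f : S) : isaut h -> transport (V := Aobj) h (sval f) = sval (h f).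
Proof. by move=> hA; apply: funext => y; rewrite (rep_ofP hA). Qed.

Lemma isaut_inv h : isaut h -> exists2 k, isaut k & cancel h k /\ cancel k h.
Proof.
move=> [[k hk kh] hH]; exists k => //; split; first by exists h.
move=> f a; apply: (can_inj hk); rewrite kh hH; congr (fbp_op _ _).
by apply: funext => i; rewrite kh.
Qed.

Lemma transport_onto (V : obj kact) h (P : cantor -> V) y : isaut h -> filtered_map P ->
  exists y' b, oact (transport h P y') b = P y.
Proof.
move=> hA fP; have [k kA [hk kh]] := isaut_inv hA.
have [Fs HFs] := fbp_separates fP.
exists ((rep_of k).1 y), ((rep_of k).2 y); rewrite -[RHS]oact1 -oactM; apply: HFs => f _.
by rewrite aactM -(rep_ofP hA) -(rep_ofP kA) aact1 hk.
Qed.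

Lemma twist_aut (f g : cantor -> cantor) (b : cantor -> gT) :
  continuous_map f -> continuous_map g -> cantor_continuous b ->
  cancel f g -> cancel g f -> (forall i, f (x i) = x i) -> (forall i, b (x i) = 1%g) ->
  exists h, isaut h /\ rep h (f, b).
Proof.
move=> cf cg cb fg gf fx bx.
have cont (f' : cantor -> cantor) (b' : cantor -> gT) (s : S) :
    continuous_map f' -> cantor_continuous b' ->
    (forall i, f' (x i) = x i) -> (forall i, b' (x i) = 1%g) ->
    in_fbp x e (fun y => aact (sval s (f' y)) (b' y)).
  move=> cf' cb' fx' bx'; split; last by move=> i; rewrite fx' bx' aact1 (proj2 (svalP s)).
  apply: (continuous_glue (c := fun t y => aact (sval s (f' y)) t)) => // t.
  apply: (continuous_comp (aact^~ t)); exact: continuous_precomp cf' (proj1 (svalP s)).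
pose h s : S := exist _ _ (cont f b s cf cb fx bx).
have gx i : g (x i) = x i by rewrite -{1}fx fg.
(* The cocycle of the inverse automorphism. *)
pose b' y := ((b (g y))^-1)%g.
have cb' : cantor_continuous b'.
  apply: (continuous_comp (@invg gT)); exact: continuous_precomp cg cb.
have bx' i : b' (x i) = 1%g by rewrite /b' gx bx invg1.
pose k s : S := exist _ _ (cont g b' s cg cb' gx bx').
exists h; split=> //; split.
  exists k => s; apply: fbp_inj; apply: funext => y /=.
    by rewrite gf -aactM /b' mulgV aact1.
  by rewrite fg -aactM /b' fg mulVg aact1.
by move=> o a; apply: fbp_inj; apply: funext => y /=; rewrite aact_op.
Qed.

(** * Graphs of tuples of automorphisms and their realisation *)

Section Tuples.
Variable m : nat.
Notation inG := (in_Gn isaut (n := m)).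

Definition agraph (V : obj kact) (h : 'I_m -> S -> S) (P : cantor -> V) (j : 'I_m) (v w : V) :=
  exists y b, v = oact (P y) b /\ w = oact (transport (h j) P y) b.

Lemma agraph_img (V V' : obj kact) h (p : V -> V') (P : cantor -> V) :
  morph p -> img p (agraph h P) = agraph h (fun y => p (P y)).
Proof.
move=> pM; apply: rel_ext => j v w; split.
  move=> [v' [w' [[y [b [-> ->]]] <- <-]]]; exists y, b.
  by rewrite transport_morph // !(proj1 pM).
move=> [y [b [-> ->]]]; exists (oact (P y) b), (oact (transport (h j) P y) b).
by rewrite transport_morph // !(proj1 pM); split=> //; exists y, b.
Qed.

Lemma agraph_live (V : obj kact) h (P : cantor -> V) y b :
  inG h -> filtered_map P -> live (agraph h P) (oact (P y) b).
Proof.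
move=> hG fP [j []]; rewrite /lrel /=; first by exists (oact (transport (h j) P y) b), y, b.
have [y' [c E]] := transport_onto y (hG j) fP.
by exists (oact (P y') (c * b)%g), y', (c * b)%g; rewrite (oactM (transport _ _ _)) E.
Qed.

Lemma agraph_valid (V : obj kact) h (P : cantor -> V) : inG h -> filtered_map P -> valid (agraph h P).
Proof.
move=> hG fP; split.
- by move=> j v w c [y [b [-> ->]]]; exists y, (b * c)%g; rewrite !oactM.
- case=> j [] v w; rewrite /lrel /= => -[y [b [E1 E2]]]; rewrite ?E1 ?E2.
    exact: agraph_live.
  rewrite /transport -oactM; exact: agraph_live.
- move=> j c; have [i [b ->]] := K_generated c; exists (x i), b.
  by rewrite (proj2 (transport_funs (hG j) fP)) (proj2 fP) oactio.
Qed.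

Lemma agraph_vertex (V : obj kact) h (P : cantor -> V) s v w :
  lrel (agraph h P) s v w -> exists y b, v = oact (P y) b.
Proof.
case: s => j []; rewrite /lrel /= => -[y [b [E1 E2]]]; first by exists y, b.
by rewrite E2 /transport -oactM; exists ((rep_of (h j)).1 y), ((rep_of (h j)).2 y * b)%g.
Qed.

Lemma agraph_determined (V : obj kact) (P : cantor -> V) : filtered_map P ->
  exists Fs : seq S, forall h k, inG h -> inG k -> agree_on Fs h k -> agraph h P = agraph k P.
Proof.
move=> fP; have [Fs HFs] := transport_determined fP; exists Fs => h k hG kG H.
have E j : transport (h j) P = transport (k j) P by apply: HFs => // f; apply: H.
by apply: rel_ext => j v w; split=> -[y [b [-> ->]]]; exists y, b; rewrite E.
Qed.

(* The finest map of level [N]: every map of level [N] factors through it. *)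
Definition univ_map N : cantor -> free_obj kact1 kactM {ffun 'I_N -> bool} :=
  fix_near (V := free_obj kact1 kactM {ffun 'I_N -> bool}) N (fun y => inr (bits N y, 1%g)).

Lemma univ_map_funs N : sep_level <= N -> filtered_map (univ_map N).
Proof.
move=> HN; apply: fix_near_funs => //.
by apply: (continuous_comp (fun u => inr (u, 1%g))); apply: continuous_bits.
Qed.

Lemma univ_map_factor (V : obj kact) N (Q : cantor -> V) : filtered_map Q -> level N Q ->
  forall y, Q y = free_lift (fun u => Q (bits_ext u)) (univ_map N y).
Proof.
move=> fQ lQ y; rewrite /univ_map /fix_near; case: (nearP N y) => [[i -> E]|[-> _]] /=.
  exact: filtered_map_near fQ lQ E.
by rewrite oact1 level_ext.
Qed.

(** At a high level each [f] in [Fs] and each [h j f] factor through [univ_map M], so the value of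
    [h j f] can be read off the starting vertex of an edge and that of [k j f] off its end. Hence
    equal graphs force equal values. *)
Lemma agraph_agree h (Fs : seq S) : inG h ->
  exists2 M0, sep_level <= M0 & forall M k, M0 <= M -> inG k ->
    agraph k (univ_map M) = agraph h (univ_map M) -> agree_on Fs h k.
Proof.
move=> hG.
have [M0 HM0 lM0] : exists2 M0, sep_level <= M0 & forall f, List.In f Fs ->
    level M0 (sval f) /\ forall j, level M0 (sval (h j f)).
  elim: Fs => [|f Gs [M HM IH]]; first by exists sep_level.
  have [N1 H1] := continuous_level (proj1 (svalP f)).
  have [N2 H2] := choice (fun j => continuous_level (proj1 (svalP (h j f)))).
  exists (maxn M (maxn N1 (\max_j N2 j))); first by rewrite leq_max HM.
  move=> g /= [<-|/IH [g1 g2]]; split=> [|j].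
  - by apply: level_mono H1; rewrite !leq_max leqnn orbT.
  - apply: level_mono (H2 j); rewrite !leq_max; apply/orP; right; apply/orP; right.
    exact: leq_bigmax.
  - by apply: level_mono g1; rewrite leq_maxl.
  - by apply: level_mono (g2 j); rewrite leq_maxl.
exists M0 => // M k HM kG E j f /lM0 [l1 l2].
have fP := univ_map_funs (leq_trans HM0 HM).
have ff (g : S) : filtered_map (V := Aobj) (sval g) by exact: svalP g.
have F1 := univ_map_factor (V := Aobj) (ff f) (level_mono HM l1).
have F2 := univ_map_factor (V := Aobj) (ff (h j f)) (level_mono HM (l2 j)).
set q1 := free_lift _ in F1; set q2 := free_lift _ in F2.
have q1M : morph q1 := free_lift_morph _ _ _.
have q2M : morph q2 := free_lift_morph _ _ _.
apply: fbp_inj; apply: funext => y.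
rewrite -(transport_fbp f (kG j)).
have -> : sval f = fun y => q1 (univ_map M y) by apply: funext.
rewrite transport_morph //.
have : agraph h (univ_map M) j (univ_map M y) (transport (k j) (univ_map M) y).
  by rewrite -E; exists y, 1%g; rewrite !oact1.
move=> [y' [b [E1 E2]]]; rewrite E2 (proj1 q1M).
have -> : q1 (transport (h j) (univ_map M) y') = sval (h j f) y'.
  rewrite -(transport_fbp f (hG j)).
  have -> : sval f = fun y => q1 (univ_map M y) by apply: funext.
  by rewrite transport_morph.
by rewrite F2 E1 (proj1 q2M) -F2.
Qed.

(* Diagonalisation: [y] differs from [x i] at position [N + i]. *)
Lemma avoid_points N y0 : exists2 y, bits N y = bits N y0 & near (N + n) y = None.
Proof.
pose y : cantor := fun k => if k < N then y0 k else
  if insub (k - N) is Some i then ~~ x i k else false.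
exists y; first by apply/bitsP => k kN; rewrite /y kN.
case: (nearP (N + n) y) => [[i _ /bitsP/(_ (N + i))]|[]//].
rewrite ltn_add2l ltn_ord /y ltnNge leq_addr /= addKn valK => /(_ isT).
by case: (x i _).
Qed.

(** The cells of [p] are coloured one by one with [clopen_split]. All colours must occur inside [Y],
    the region away from the [x i], because nearer to these points the values are prescribed. *)
Lemma split_onto (V : Type) (T : finType) (p : cantor -> V) (Y : cantor -> bool)
    (TS : V -> seq T) :
  cantor_continuous p -> cantor_continuous Y ->
  (forall y0, exists2 y, Y y & p y = p y0) -> (forall y0, TS (p y0) != [::]) ->
  exists D, [/\ cantor_continuous D, forall y, D y \in TS (p y) &
    forall y0 t, t \in TS (p y0) -> exists y, [/\ Y y, p y = p y0 & D y = t]].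
Proof.
move=> cp cY HY HT.
have H v : exists c : cantor -> T, cantor_continuous c /\ ((exists y0, p y0 = v) ->
    (forall y, c y \in TS v) /\ forall t, t \in TS v -> exists y, [/\ Y y, p y = v & c y = t]).
  have [[y0 <-]|H] := EM (exists y0, p y0 = v); last first.
    have := HT (fun _ => false); case: (TS _) => // t0 _ _.
    by exists (fun _ => t0); split=> //; apply: continuous_cst.
  have [||c [cc c1 c2]] := @clopen_split T (fun y => Y y && `[< p y = p y0 >]) (TS (p y0)) _ _ (HT y0).
  - have := continuous_pair cY cp => /(continuous_comp (fun u => u.1 && `[< u.2 = p y0 >])).
    by [].
  - by have [y Yy E] := HY y0; exists y; rewrite Yy; apply/asboolP.
  exists c; split=> // _; split=> // t /c2 [y /andP [Yy /asboolP E] <-]; by exists y.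
have [c Hc] := choice H; exists (fun y => c (p y) y); split.
- by apply: continuous_glue => // t; case: (Hc t).
- by move=> y; case: (Hc (p y)) => _ [|Hy _]; [exists y|apply: Hy].
- move=> y0 t Ht; case: (Hc (p y0)) => _ [|_ /(_ _ Ht) [y [Yy E <-]]]; first by exists y0.
  by exists y; rewrite E.
Qed.

Lemma away_clopen (V : Type) N (p : cantor -> V) : level N p ->
  forall y0, exists2 y, near (N + n) y == None & p y = p y0.
Proof. by move=> lp y0; have [y /lp E En] := avoid_points N y0; exists y; rewrite ?En. Qed.

Lemma continuous_away N : cantor_continuous (fun y => near N y == None).
Proof. by apply: (continuous_comp (fun o => o == None)); apply: level_continuous (@near_level N). Qed.

Lemma refine_funs (V V' : obj kact) (p : cantor -> V) (q : V' -> V) (L : V' -> Prop) :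
  filtered_map p -> morph q -> (forall i, L (oio V' (idemK i))) ->
  (forall y, exists2 v', L v' & q v' = p y) ->
  exists p', [/\ filtered_map p', forall y, q (p' y) = p y, forall y, L (p' y) &
    forall v' y, L v' -> q v' = p y -> exists y', p' y' = v'].
Proof.
move=> fp qM Lx Hq; have [N HN lp] := filtered_map_level fp.
pose TS v := [seq v' <- enum V' | `[< L v' >] && (q v' == v)].
have memTS v v' : (v' \in TS v) = `[< L v' >] && (q v' == v).
  by rewrite mem_filter mem_enum andbT.
(* By [avoid_points], at level [N + n] every cell of [p] still has points outside the cylinders of
   the [x i]. *)
have [||D [cD D1 D2]] := @split_onto V V' p _ TS (proj1 fp) (continuous_away (N + n)).
- exact: away_clopen.
- move=> y; have [v' Lv' E] := Hq y.
  have : v' \in TS (p y) by rewrite memTS E eqxx andbT; apply/asboolP.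
  by case: (TS _).
have HM := leq_trans HN (leq_addr n N).
exists (fix_near (N + n) D); split.
- exact: fix_near_funs.
- move=> y; rewrite /fix_near; case: (nearP (N + n) y) => [[i -> /(bits_mono (leq_addr n N)) E]|[-> _]].
    by rewrite (proj2 qM) (filtered_map_near fp lp E).
  by have := D1 y; rewrite memTS => /andP [_ /eqP].
- move=> y; rewrite /fix_near; case: (near _ y) => [i|] //.
  by have := D1 y; rewrite memTS => /andP [/asboolP].
- move=> v' y Lv' E; have [|y' [/eqP Yy' _ <-]] := D2 y v'.
    by rewrite memTS E eqxx andbT; apply/asboolP.
  by exists y'; rewrite /fix_near Yy'.
Qed.

Lemma clopen_homeo_total (U : cantor -> bool) : cantor_continuous U ->
  exists fg : (cantor -> cantor) * (cantor -> cantor),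
  [/\ continuous_map fg.1, continuous_map fg.2 & (exists y, U y) ->
    [/\ forall y, U (fg.1 y), forall y, fg.2 (fg.1 y) = y & forall u, U u -> fg.1 (fg.2 u) = u]].
Proof.
move=> cU; have [Une|H] := EM (exists y, U y); last first.
  by exists (id, id); split=> //; apply: continuous_map_id.
by have [f [g []]] := clopen_homeo cU Une; exists (f, g).
Qed.

(** On [Y] the colourings [D] and [C] take the same values. For each of these both fibres are
    nonempty clopen sets, and they are matched through the Cantor space. *)
Lemma fiber_homeo (T : finType) (Y : cantor -> bool) (D C : cantor -> T) :
  cantor_continuous Y -> cantor_continuous D -> cantor_continuous C ->
  (forall y, Y y -> exists2 z, Y z & C z = D y) ->
  (forall y, Y y -> exists2 z, Y z & D z = C y) ->
  exists f g, [/\ continuous_map f, continuous_map g, cancel f g, cancel g f &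
    [/\ forall y, ~~ Y y -> f y = y & forall y, Y y -> Y (f y) /\ C (f y) = D y]].
Proof.
move=> cY cD cC HDC HCD.
have cU (E : cantor -> T) t : cantor_continuous E -> cantor_continuous (fun y => Y y && (E y == t)).
  move=> cE; have := continuous_pair cY cE => /(continuous_comp (fun u => u.1 && (u.2 == t))).
  by [].
have [a Ha] := choice (fun t => clopen_homeo_total (cU D t cD)).
have [c Hc] := choice (fun t => clopen_homeo_total (cU C t cC)).
pose f y := if Y y then (c (D y)).1 ((a (D y)).2 y) else y.
pose g y := if Y y then (a (C y)).1 ((c (C y)).2 y) else y.
have aP y : Y y -> [/\ forall z, Y ((a (D y)).1 z) /\ D ((a (D y)).1 z) = D y,
    forall z, (a (D y)).2 ((a (D y)).1 z) = z & (a (D y)).1 ((a (D y)).2 y) = y].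
  move=> Yy; have [_ _ []] := Ha (D y); first by exists y; rewrite Yy eqxx.
  by move=> h1 h2 h3; split=> [z||]; [case/andP: (h1 z) => ? /eqP|exact: h2|apply: h3; rewrite Yy eqxx].
have cP y : Y y -> [/\ forall z, Y ((c (C y)).1 z) /\ C ((c (C y)).1 z) = C y,
    forall z, (c (C y)).2 ((c (C y)).1 z) = z & (c (C y)).1 ((c (C y)).2 y) = y].
  move=> Yy; have [_ _ []] := Hc (C y); first by exists y; rewrite Yy eqxx.
  by move=> h1 h2 h3; split=> [z||]; [case/andP: (h1 z) => ? /eqP|exact: h2|apply: h3; rewrite Yy eqxx].
have fP y : Y y -> Y (f y) /\ C (f y) = D y.
  move=> Yy; have [z Yz E] := HDC y Yy; rewrite /f Yy -E.
  by have [h1 _ _] := cP z Yz; apply: h1.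
have gP y : Y y -> Y (g y) /\ D (g y) = C y.
  move=> Yy; have [z Yz E] := HCD y Yy; rewrite /g Yy -E.
  by have [h1 _ _] := aP z Yz; apply: h1.
exists f, g; split.
- apply: continuous_map_if => //; last exact: continuous_map_id.
  apply: (continuous_map_glue (f := fun t y => (c t).1 ((a t).2 y))) => // t.
  by apply: continuous_map_comp; [case: (Hc t)|case: (Ha t)].
- apply: continuous_map_if => //; last exact: continuous_map_id.
  apply: (continuous_map_glue (f := fun t y => (a t).1 ((c t).2 y))) => // t.
  by apply: continuous_map_comp; [case: (Ha t)|case: (Hc t)].
- move=> y; case Yy: (Y y); last by rewrite /f Yy /g Yy.
  have [Yf Cf] := fP y Yy; rewrite /g Yf Cf /f Yy.
  have [z Yz E] := HDC y Yy; rewrite -{2 3}E; have [_ -> _] := cP z Yz.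
  by have [_ _] := aP y Yy.
- move=> y; case Yy: (Y y); last by rewrite /g Yy /f Yy.
  have [Yg Dg] := gP y Yy; rewrite /f Yg Dg /g Yy.
  have [z Yz E] := HCD y Yy; rewrite -{2 3}E; have [_ -> _] := aP z Yz.
  by have [_ _] := cP y Yy.
- by split=> // y; rewrite /f => /negPf ->.
Qed.

(* The automorphism is the identity near the [x i]; elsewhere, the cells of [p] are
   cut into clopen pieces, one for each edge, and matched by homeomorphisms. *)
Lemma realize_rel (V : obj kact) (p : cantor -> V) (R : V -> V -> Prop) :
  filtered_map p -> (forall v w b, R v w -> R (oact v b) (oact w b)) ->
  (forall y, exists w, R (p y) w) -> (forall y, exists w, R w (p y)) ->
  (forall v w, R v w -> exists y1 b1 y2 b2, v = oact (p y1) b1 /\ w = oact (p y2) b2) ->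
  (forall i, R (p (x i)) (p (x i))) ->
  exists h, isaut h /\
    forall v w, R v w <-> exists y b, v = oact (p y) b /\ w = oact (transport h p y) b.
Proof.
move=> fp Rinv Rout Rin Rp Rx; have [N HN lp] := filtered_map_level fp.
pose Y y := near (N + n) y == None.
have cY : cantor_continuous Y := continuous_away _.
(* A colour [(v, w, b)] stands for the edge from [v] to [oact w b], with [v] and [w] values of [p].
   By invariance these represent all edges up to translation. *)
pose T : finType := (V * V * gT)%type.
pose ok (t : T) := [/\ exists y, p y = t.1.1, exists y, p y = t.1.2 & R t.1.1 (oact t.1.2 t.2)].
pose TS1 v := [seq t <- enum T | `[< ok t >] && (t.1.1 == v)].
pose TS2 v := [seq t <- enum T | `[< ok t >] && (t.1.2 == v)].
have TS1P v t : t \in TS1 v <-> ok t /\ t.1.1 = v.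
  by rewrite mem_filter mem_enum andbT; split=> [/andP [/asboolP ? /eqP]|[/asboolP -> /eqP]].
have TS2P v t : t \in TS2 v <-> ok t /\ t.1.2 = v.
  by rewrite mem_filter mem_enum andbT; split=> [/andP [/asboolP ? /eqP]|[/asboolP -> /eqP]].
have [||D [cD D1 D2]] := @split_onto V T p Y TS1 (proj1 fp) cY.
- exact: away_clopen.
- move=> y; have [w Rw] := Rout y; have [_ [_ [y2 [b2 [_ E]]]]] := Rp _ _ Rw.
  suff: (p y, p y2, b2) \in TS1 (p y) by case: (TS1 _).
  by apply/TS1P; split=> //; split; [exists y|exists y2|rewrite -E].
have [||C [cC C1 C2]] := @split_onto V T p Y TS2 (proj1 fp) cY.
- exact: away_clopen.
- move=> y; have [w Rw] := Rin y; have [y1 [b1 [_ [_ [E _]]]]] := Rp _ _ Rw.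
  suff: (p y1, p y, b1^-1)%g \in TS2 (p y) by case: (TS2 _).
  apply/TS2P; split=> //; split; [by exists y1|by exists y|].
  by rewrite /= -(oactK (p y1) b1) -E; apply: Rinv.
(* [D] colours a point by an edge leaving its cell, [C] by an edge that enters it up to translation.
   As [f] carries colour to colour, [p (f y)] is the second component of [D y]. *)
have [||f [g [cf cg fg gf [fY fP]]]] := fiber_homeo cY cD cC.
- move=> y _; have /TS1P [ok1 E] := D1 y; have [_ [y2 E2] _] := ok1.
  have [|z [Yz _ Cz]] := C2 y2 (D y); first by apply/TS2P.
  by exists z.
- move=> y _; have /TS2P [ok1 E] := C1 y; have [[y2 E2] _ _] := ok1.
  have [|z [Yz _ Cz]] := D2 y2 (C y); first by apply/TS1P.
  by exists z.
pose b y : gT := if Y y then (D y).2 else 1%g.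
have Yx i : Y (x i) = false by rewrite /Y near_x // (leq_trans HN) // leq_addr.
have [|||h [hA hr]] := @twist_aut f g b cf cg _ fg gf.
- by apply: continuous_if => //; [exact: continuous_comp|exact: continuous_cst].
- by move=> i; rewrite fY ?Yx.
- by move=> i; rewrite /b Yx.
have hE y : transport h p y = oact (p (f y)) (b y) by rewrite (transport_rep _ hA hr).
have hY y : Y y -> transport h p y = oact (D y).1.2 (D y).2.
  move=> Yy; rewrite hE /b Yy; have [Yf Cf] := fP y Yy.
  by have /TS2P [_] := C1 (f y); rewrite Cf => ->.
exists h; split=> // v w; split.
  move=> Rvw; have [y1 [b1 [y2 [b2 [Ev Ew]]]]] := Rp _ _ Rvw.
  have [|y [Yy E1 ED]] := D2 y1 (p y1, p y2, b2 * b1^-1)%g.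
    apply/TS1P; split=> //; split; [by exists y1|by exists y2|].
    by rewrite /= oactM -(oactK (p y1) b1) -Ev -Ew; apply: Rinv.
  by exists y, b1; rewrite hY // ED E1 /= -oactM mulgKV.
move=> [y [c [-> ->]]]; apply: Rinv.
case Yy: (Y y).
  by rewrite hY //; have /TS1P [[_ _ HR] <-] := D1 y.
rewrite hE /b Yy fY ?Yy // oact1; move: Yy; rewrite /Y.
case: (nearP (N + n) y) => [[i _ /(bits_mono (leq_addr n N))/lp ->] _|[-> //]].
exact: Rx.
Qed.

(** First [p] is refined until its values meet every live vertex up to translation; then
    [realize_rel] treats each generator separately. *)
Lemma realize (j0 : 'I_m) (V V' : obj kact) (p : cantor -> V) (q : V' -> V)
    (R : 'I_m -> V' -> V' -> Prop) :
  filtered_map p -> morph q -> valid R ->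
  (forall v', live R v' -> exists y b, q v' = oact (p y) b) ->
  (forall y, exists2 v', live R v' & q v' = p y) ->
  exists p' h, [/\ filtered_map p', inG h, forall y, q (p' y) = p y, agraph h p' = R &
    forall y, live R (p' y)].
Proof.
move=> fp qM Rv Hl Hc.
have lx c : live R (oio V' c).
  apply: (valid_live (s := (j0, true)) (w := oio V' c) Rv); exact: (valid_loop Rv).
have [p' [fp' qp' lp' onto]] := refine_funs fp qM (fun i => lx _) Hc.
have hit v : live R v -> exists y b, v = oact (p' y) b.
  move=> l; have [y [b E]] := Hl _ l.
  have [||y' E'] := onto (oact v b^-1%g) y; first exact: live_inv.
    by rewrite (proj1 qM) E oactK.
  by exists y', b; rewrite E' oactKV.
have H j : exists h, isaut h /\ forall v w,
    R j v w <-> exists y b, v = oact (p' y) b /\ w = oact (transport h p' y) b.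
  apply: realize_rel => //.
  - by move=> v w b; apply: valid_inv.
  - by move=> y; apply: (lp' y (j, true)).
  - by move=> y; apply: (lp' y (j, false)).
  - move=> v w Rvw.
    have [y1 [b1 E1]] := hit v (valid_live (s := (j, true)) Rv Rvw).
    have [y2 [b2 E2]] := hit w (valid_live_r (s := (j, true)) Rv Rvw).
    by exists y1, b1, y2, b2.
  - by move=> i; rewrite (proj2 fp'); apply: valid_loop.
have [h Hh] := choice H; exists p', h; split=> //.
  by move=> j; case: (Hh j).
by apply: rel_ext => j v w; case: (Hh j) => _ ->.
Qed.

Notation FO := (free_obj kact1 kactM).

Lemma filtered_map_comp (V V' : obj kact) (p : V -> V') (P : cantor -> V) :
  morph p -> filtered_map P -> filtered_map (fun y => p (P y)).
Proof.
move=> [_ pio] [cP Px]; split; first exact: continuous_comp.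
by move=> i; rewrite Px pio.
Qed.

(** Renames the generators by ordinals, bringing a free object into the countable family used in the
    conditions. *)
Definition free_code (W : finType) : FO W -> FO 'I_#|W| :=
  free_lift (V := FO 'I_#|W|) (fun w => inr (enum_rank w, 1%g)).
Definition free_decode (W : finType) : FO 'I_#|W| -> FO W :=
  free_lift (V := FO W) (fun i => inr (enum_val i, 1%g)).

Lemma free_codeK W : cancel (@free_code W) (@free_decode W).
Proof. by case=> [c|[w a]] //=; rewrite enum_rankK !mul1g. Qed.

Lemma univ_map_level N : level N (univ_map N).
Proof. by move=> y z E; rewrite /univ_map /fix_near (near_level E) E. Qed.

Lemma univ_map_refine N M : sep_level <= N -> N <= M ->
  exists2 q : FO {ffun 'I_M -> bool} -> FO {ffun 'I_N -> bool},
    morph q & forall y, q (univ_map M y) = univ_map N y.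
Proof.
move=> HN NM; exists (free_lift (fun u => univ_map N (bits_ext u))).
  exact: free_lift_morph.
move=> y; rewrite -univ_map_factor //; first exact: univ_map_funs.
exact: level_mono (@univ_map_level N).
Qed.

Variable j0 : 'I_m.

(** The common core of the density proofs. A graph lying over that of [h] at level [M] is realised
    by some [k]; the graph of [k] on [univ_map M] is its image, so [agraph_agree] yields agreement
    on [Fs]. *)
Lemma dense_realize h (Fs : seq S) M1 : inG h ->
  exists M, [/\ M1 <= M, sep_level <= M &
  forall (V : obj kact) (q : V -> FO {ffun 'I_M -> bool}) (R : 'I_m -> V -> V -> Prop),
    morph q -> valid R -> img q R = agraph h (univ_map M) ->
    exists p k, [/\ inG k, agree_on Fs h k, filtered_map p & [/\ forall y, q (p y) = univ_map M y,
      agraph k p = R & forall y, live R (p y)]]].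
Proof.
move=> hG; have [M0 HM0 HM] := agraph_agree Fs hG.
exists (maxn M0 M1); split; first exact: leq_maxr.
  by rewrite leq_max HM0.
move=> V q R qM Rv qR; set M := maxn M0 M1 in q qM qR *.
have fP : filtered_map (univ_map M) by apply: univ_map_funs; rewrite leq_max HM0.
have [||p [k [fp kG qp kp lp]]] := realize j0 fP qM Rv.
- move=> v l; have [w Hw] := l (j0, true).
  by have := img_lrel q Hw; rewrite qR => /agraph_vertex.
- move=> y; have : agraph h (univ_map M) j0 (univ_map M y) (transport (h j0) (univ_map M) y).
    by exists y, 1%g; rewrite !oact1.
  rewrite -qR => -[v [w [Rvw E _]]]; exists v => //.
  exact: (valid_live (s := (j0, true)) Rv Rvw).
exists p, k; split=> //; apply: (HM M) => //; first exact: leq_maxl.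
have -> : univ_map M = fun y => q (p y) by apply: funext => y; rewrite qp.
rewrite -agraph_img // kp qR; congr (agraph h _); by apply: funext => y; rewrite qp.
Qed.

(** * The open dense conditions defining generic tuples *)

Definition start_cond h := exists p : cantor -> FO 'I_1, filtered_map p /\ agraph h p = @triv_rel _ _ _ _ _ m _.

Definition refine_cond N h :=
  exists a (p : cantor -> FO 'I_a) (q : FO 'I_a -> FO {ffun 'I_(sep_level + N) -> bool}),
  [/\ filtered_map p, morph q, forall y, q (p y) = univ_map (sep_level + N) y & good (agraph h p)].

(** The extension property: a graph over the good graph of [p] is realised by a lift of [p]. The
    premises belong to the condition, so that it makes sense for arbitrary data and can be
    enumerated. *)
Definition lift_cond a b (p : cantor -> FO 'I_a) (q : FO 'I_b -> FO 'I_a)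
    (R : 'I_m -> FO 'I_b -> FO 'I_b -> Prop) h :=
  filtered_map p -> morph q -> valid R -> good (img q R) -> agraph h p = img q R ->
  exists p', [/\ filtered_map p', forall y, q (p' y) = p y & agraph h p' = R].

Lemma start_open : open_in isaut start_cond.
Proof.
move=> h hG [p [fp E]]; have [Fs HF] := agraph_determined fp.
by exists Fs => k kG /(HF _ _ hG kG) E'; exists p; rewrite -E'.
Qed.

Lemma refine_open N : open_in isaut (refine_cond N).
Proof.
move=> h hG [a [p [q [fp qM qp gd]]]]; have [Fs HF] := agraph_determined fp.
by exists Fs => k kG /(HF _ _ hG kG) E'; exists a, p, q; rewrite -E'.
Qed.

Lemma lift_open a b p q R : open_in isaut (@lift_cond a b p q R).
Proof.
move=> h hG H.
have [fp|nf] := EM (filtered_map p); last by exists [::] => k _ _ /nf.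
have [Fs HF] := agraph_determined fp.
have [[qM Rv gd E]|no] := EM [/\ morph q, valid R, good (img q R) & agraph h p = img q R]; last first.
  (* Nearby tuples have the same graph on [p], so a premise failing at [h] fails at [k] as well. *)
  exists Fs => k kG /(HF _ _ hG kG) E' _ qM Rv gd E; case: no; split=> //.
  by rewrite E'.
have [p' [fp' qp' E']] := H fp qM Rv gd E; have [Fs' HF'] := agraph_determined fp'.
exists Fs' => k kG /(HF' _ _ hG kG) E'' _ _ _ _ _; exists p'; split=> //.
by rewrite -E''.
Qed.

(** A cover of the graph of [h] is realised and then projected to one free orbit, keeping only the
    group coordinate. Edges preserve that coordinate, so the image is equality. *)
Lemma start_dense : dense_in isaut start_cond.
Proof.
move=> h Fs hG; have [M [_ HM dense]] := dense_realize Fs 0 hG.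
have fP := univ_map_funs HM.
have [R [Rv Rg Ri R1 R2]] := cover_exists kact1 kactM (agraph_valid hG fP).
have [p [k [kG ag fp [qp kp lp]]]] := dense _ _ _ (free_lift_morph _ _ _) Rv Ri.
exists k; split=> //.
pose c : FO _ -> FO 'I_1 :=
  free_lift (V := FO 'I_1) (fun _ : FO {ffun 'I_M -> bool} * letter m => inr (ord0, 1%g)).
have cM : morph c := free_lift_morph _ _ _.
exists (fun y => c (p y)); split; first exact: filtered_map_comp.
rewrite -agraph_img // kp; apply: rel_ext => j v w; split.
  move=> [v' [w' [/R1 H <- <-]]]; rewrite /triv_rel.
  by case: v' w' H => [d|[vt a]] [d'|[wt b]] //= ->.
move=> <-; case: v => [d|[i a]].
  by exists (inl d), (inl d); split=> //; apply: (valid_loop Rv).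
have : agraph h (univ_map M) j (univ_map M (fun _ => false)) (transport (h j) (univ_map M) (fun _ => false)).
  by exists (fun _ => false), 1%g; rewrite !oact1.
move=> /R2 [v1 [w1 H]]; have Rvw := valid_inv Rv a H; rewrite (ord1 i).
by exists (inr (v1, a)), (inr (w1, a)); rewrite /= !mul1g in Rvw *.
Qed.

(** The graph of [h] at a high level is replaced by its good cover. *)
Lemma refine_dense N : dense_in isaut (refine_cond N).
Proof.
move=> h Fs hG; have [M [HN HM dense]] := dense_realize Fs (sep_level + N) hG.
have fP := univ_map_funs HM.
have [R [Rv Rg Ri _ _]] := cover_exists kact1 kactM (agraph_valid hG fP).
have [p [k [kG ag fp [qp kp lp]]]] := dense _ _ _ (free_lift_morph _ _ _) Rv Ri.
have [q qM qP] := univ_map_refine (leq_addr N sep_level) HN.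
exists k; split=> //; exists _, (fun y => free_code (p y)).
exists (fun v => q (cover_proj (m := m) (V := FO {ffun 'I_M -> bool}) (free_decode v))); split.
- by apply: filtered_map_comp => //; apply: free_lift_morph.
- apply: morph_comp => //; apply: morph_comp; exact: free_lift_morph.
- by move=> y; rewrite free_codeK -qP -qp.
- rewrite -agraph_img; last exact: free_lift_morph.
  rewrite kp; apply: (good_iso (q := @free_decode _)) => //; last exact: free_codeK.
  exact: free_lift_morph.
Qed.

(** The graph of [h] at a high level is amalgamated with [R] over the graph of [p]. The second
    component of a realisation of the amalgam is the required lift. *)
Lemma lift_dense a b N p q R : level N p -> dense_in isaut (@lift_cond a b p q R).
Proof.
move=> lp h Fs hG.
have [[fp qM Rv [gd E]]|no] := EM [/\ filtered_map p, morph q, valid R & good (img q R) /\ agraph h p = img q R];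
  last by exists h; split=> // fp qM Rv gd E; case: no.
have [M [HN HM dense]] := dense_realize Fs N hG.
have fP := univ_map_funs HM.
have fac := univ_map_factor fp (level_mono HN lp).
set r := free_lift _ in fac; have rM : morph r := free_lift_morph _ _ _.
have rE : img r (agraph h (univ_map M)) = img q R.
  by rewrite agraph_img // -E; congr (agraph h _); apply: funext.
have [|R3 [R3v R31 R32 R3e]] := amalgamation rM qM (agraph_valid hG fP) Rv rE; first by rewrite rE.
have [p3 [k [kG ag fp3 [qp kp l3]]]] := dense _ _ _ (fst_morph _ _) R3v R31.
exists k; split=> // _ _ _ _ _; exists (fun y => (p3 y).2); split.
- exact: (filtered_map_comp (snd_morph _ _)).
- move=> y; have [w Hw] := l3 y (j0, true).
  by rewrite -(R3e _ _ _ Hw) qp -fac.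
- have := agraph_img k p3 (snd_morph (FO {ffun 'I_M -> bool}) (FO 'I_b)).
  by move=> <-; rewrite kp.
Qed.

(** * Countability and Baire category *)

Lemma fbp_enum : exists en : nat -> S, forall s, exists i, en i = s.
Proof.
have [a0 [_ _]] := A_nontrivial.
have s0 : S := exist _ _ (fix_near_funs (V := Aobj) (leqnn sep_level) (continuous_cst a0)).
pose T := {N : nat & {ffun {ffun 'I_N -> bool} -> A}}.
pose dec (c : T) : S :=
  if pselect (in_fbp x e (fun y => tagged c (bits (tag c) y))) is left H
  then exist _ _ H else s0.
exists (fun i => if unpickle i is Some c then dec c else s0) => s.
have [N HN] := continuous_level (proj1 (svalP s)).
pose c : T := @Tagged _ N (fun N => {ffun {ffun 'I_N -> bool} -> A}) [ffun u => sval s (bits_ext u)].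
have E : (fun y => tagged c (bits (tag c) y)) = sval s.
  by apply: funext => y; rewrite ffunE level_ext.
exists (pickle c); rewrite pickleK /dec; case: pselect => [H|[]]; last first.
  by rewrite E; apply: svalP.
by apply: fbp_inj; rewrite /= E.
Qed.

(** Pointwise limits of automorphisms need not be onto. Stage [i] therefore freezes the value at
    [en i] and also, for each [j], at a preimage of [en i]. *)
Lemma baire (O : nat -> ('I_m -> S -> S) -> Prop) :
  (forall i, open_in isaut (O i) /\ dense_in isaut (O i)) ->
  exists2 h, inG h & forall i, O i h.
Proof.
move=> HO; have [en enP] := fbp_enum.
pose st := (('I_m -> S -> S) * seq S)%type.
pose ok i (s s' : st) := inG s.1 -> inG s'.1 /\ [/\ agree_on s.2 s.1 s'.1,
  forall k, inG k -> agree_on s'.2 s'.1 k -> O i k,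
  forall t, List.In t s.2 -> List.In t s'.2, List.In (en i) s'.2 &
  forall j, exists2 u, List.In u s'.2 & s'.1 j u = en i].
have H (si : st * nat) : exists s', ok si.2 si.1 s'.
  case: si => [[h Fs] i]; have [hG|] := EM (inG h); last by exists (h, Fs) => /=.
  have [opn dns] := HO i; have [k [kG ag Ok]] := dns _ Fs hG; have [Gs HGs] := opn _ kG Ok.
  have pre j : exists u, k j u = en i.
    by have [[k' _ kk'] _] := kG j; exists (k' (en i)).
  have [u Hu] := choice pre.
  exists (k, en i :: map u (enum 'I_m) ++ Fs ++ Gs) => _; split=> //; split=> //=.
  - move=> k' k'G H; apply: HGs => // j s Hs; apply: H; right.
    by apply/List.in_or_app; right; apply/List.in_or_app; right.
  - by move=> t Ht; right; apply/List.in_or_app; right; apply/List.in_or_app; left.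
  - by left.
  - move=> j; exists (u j) => //; right; apply/List.in_or_app; left.
    by apply: List.in_map; apply: In_mem; rewrite mem_enum.
have [nxt Hn] := choice H.
pose sq := fix sq i : st := if i is i'.+1 then nxt (sq i', i') else (fun _ => id, [::]).
have sG i : inG (sq i).1.
  elim: i => [|i IH]; last by case: (Hn (sq i, i) IH).
  by move=> j; split; [exists id|].
have sP i := (Hn (sq i, i) (sG i)).2.
have sIn i k t : i <= k -> List.In t (sq i).2 -> List.In t (sq k).2.
  move=> /subnK <-; elim: (k - i) => // d IH Ht.
  by have [_ _ h _ _] := sP (d + i); apply: h; apply: IH.
have sEq i k j t : i <= k -> List.In t (sq i).2 -> (sq k).1 j t = (sq i).1 j t.
  move=> /subnK <- Ht; elim: (k - i) => // d IH.
  have [h _ _ _ _] := sP (d + i); rewrite -IH; symmetry; apply: h.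
  by apply: sIn Ht; apply: leq_addl.
have ix t : exists i, List.In t (sq i).2.
  by have [i <-] := enP t; exists i.+1; have [_ _ _ h _] := sP i.
have [d Hd] := choice ix.
pose lim j t := (sq (d t)).1 j t.
have limE i j t : List.In t (sq i).2 -> lim j t = (sq i).1 j t.
  by move=> Ht; case/orP: (leq_total i (d t)) => le; [rewrite /lim (sEq i)|rewrite (sEq (d t) i)].
have limG : inG lim.
  move=> j; split; last first.
    move=> f a; pose M := maxn (d (fbp_op He a)) (\max_l d (a l)).
    have Ha l : List.In (a l) (sq M).2.
      by apply: sIn (Hd (a l)); rewrite leq_max leq_bigmax orbT.
    have -> : (fun l => lim j (a l)) = fun l => (sq M).1 j (a l).
      by apply: funext => l; apply: limE.
    rewrite -(proj2 (sG M j)); apply: limE.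
    by apply: sIn (Hd _); rewrite leq_maxl.
  have sur t : exists u, lim j u = t.
    have [i <-] := enP t; have [_ _ _ _ /(_ j) [u Hu Eu]] := sP i; exists u.
    by rewrite (limE i.+1).
  have [g Hg] := choice sur; exists g => // t.
  (* At stage [M] the limit is already attained at both points, and that stage is injective. *)
  pose M := maxn (d t) (d (g (lim j t))).
  apply: (bij_inj (proj1 (sG M j))).
  rewrite -!limE; first exact: Hg.
    by apply: sIn (Hd _); rewrite leq_maxl.
  by apply: sIn (Hd _); rewrite leq_maxr.
exists lim => // i; have [_ h _ _ _] := sP i; apply: h => // j t Ht.
by rewrite (limE i.+1).
Qed.

Lemma rel_code b (R : 'I_m -> FO 'I_b -> FO 'I_b -> Prop) :
  exists r : {ffun 'I_m * FO 'I_b * FO 'I_b -> bool}, R = fun j v w => r (j, v, w).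
Proof.
exists [ffun t => `[< R t.1.1 t.1.2 t.2 >]]; apply: rel_ext => j v w.
by rewrite ffunE; split=> /asboolP.
Qed.

(** A countable type of codes: a level and two numbers of orbits, then [p] as a function of
    prefixes, [q], and the relation with boolean values. *)
Definition lift_code := {t : nat * nat * nat &
  ({ffun {ffun 'I_t.1.1 -> bool} -> FO 'I_t.1.2} * {ffun FO 'I_t.2 -> FO 'I_t.1.2} *
   {ffun 'I_m * FO 'I_t.2 * FO 'I_t.2 -> bool})%type}.

Definition lift_code_cond (c : lift_code) : ('I_m -> S -> S) -> Prop :=
  let d := tagged c in
  lift_cond (fun y => d.1.1 (bits _ y)) d.1.2 (fun j v w => d.2 (j, v, w)).

Lemma lift_code_all h : (forall c, lift_code_cond c h) ->
  forall a b p q R, @lift_cond a b p q R h.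
Proof.
move=> H a b p q R fp; have [N HN lp] := filtered_map_level fp.
have [r Er] := rel_code R.
have := H (@Tagged _ (N, a, b) (fun t : nat * nat * nat =>
  {ffun {ffun 'I_t.1.1 -> bool} -> FO 'I_t.1.2} * {ffun FO 'I_t.2 -> FO 'I_t.1.2} *
   {ffun 'I_m * FO 'I_t.2 * FO 'I_t.2 -> bool})%type
  ([ffun u => p (bits_ext u)], [ffun v => q v], r)).
rewrite /lift_code_cond /= -Er.
have -> : (fun y => [ffun u => p (bits_ext u)] (bits N y)) = p.
  by apply: funext => y; rewrite ffunE level_ext.
have -> : fun_of_fin [ffun v => q v] = q by apply: funext => v; rewrite ffunE.
exact.
Qed.

Definition gen_cond (i : nat) : ('I_m -> S -> S) -> Prop :=
  if (unpickle i : option (option (nat + lift_code))) is Some c then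
    match c with
    | None => start_cond
    | Some (inl N) => refine_cond N
    | Some (inr c) => lift_code_cond c
    end
  else fun _ => True.

Lemma gen_condP i : open_in isaut (gen_cond i) /\ dense_in isaut (gen_cond i).
Proof.
rewrite /gen_cond; case: (unpickle i) => [[[N|c]|]|].
- by split; [exact: refine_open|exact: refine_dense].
- split; first exact: lift_open.
  apply: (lift_dense (N := (tag c).1.1)) => y z E; by rewrite E.
- by split; [exact: start_open|exact: start_dense].
- by split=> [h _ _|h Fs hG]; [exists [::]|exists h].
Qed.

Lemma gen_cond_all h : (forall i, gen_cond i h) ->
  [/\ start_cond h, forall N, refine_cond N h & forall a b p q R, @lift_cond a b p q R h].
Proof.
move=> H.
have Hc (c : option (nat + lift_code)) : match c with
    | None => start_cond | Some (inl N) => refine_cond N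
    | Some (inr c) => lift_code_cond c end h.
  by have := H (pickle c); rewrite /gen_cond pickleK.
split; [exact: (Hc None)|by move=> N; exact: (Hc (Some (inl N)))|].
by apply: lift_code_all => c; exact: (Hc (Some (inr c))).
Qed.

(** * Back-and-forth between two generic tuples *)

Record bf_state := BF {
  bf_size : nat;
  bf_l : cantor -> FO 'I_bf_size;
  bf_r : cantor -> FO 'I_bf_size }.

(** A finite approximation of the conjugator, which is to send [bf_l] to [bf_r]. Equal graphs
    express compatibility with the two tuples; goodness permits extension. *)
Definition bf_inv h k (s : bf_state) :=
  [/\ filtered_map (bf_l s), filtered_map (bf_r s), agraph h (bf_l s) = agraph k (bf_r s) & good (agraph h (bf_l s))].

Definition bf_ext (s s' : bf_state) := exists q : FO 'I_(bf_size s') -> FO 'I_(bf_size s),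
  [/\ morph q, forall y, q (bf_l s' y) = bf_l s y & forall y, q (bf_r s' y) = bf_r s y].

Definition refines a (p : cantor -> FO 'I_a) N := exists2 q : FO 'I_a -> FO {ffun 'I_N -> bool},
  morph q & forall y, q (p y) = univ_map N y.

Lemma bf_ext_refl s : bf_ext s s.
Proof. by exists id. Qed.

Lemma bf_ext_trans s1 s2 s3 : bf_ext s1 s2 -> bf_ext s2 s3 -> bf_ext s1 s3.
Proof.
move=> [q [qM ql qr]] [r [rM rl rr]]; exists (fun v => q (r v)); split.
- exact: morph_comp.
- by move=> y; rewrite rl ql.
- by move=> y; rewrite rr qr.
Qed.

Lemma refines_factor a (p : cantor -> FO 'I_a) N (V : obj kact) (P : cantor -> V) :
  refines p N -> filtered_map P -> level N P ->
  exists2 r : FO 'I_a -> V, morph r & forall y, P y = r (p y).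
Proof.
move=> [q qM qp] fP lP; exists (fun v => free_lift (fun u => P (bits_ext u)) (q v)).
  by apply: morph_comp => //; apply: free_lift_morph.
by move=> y; rewrite qp -univ_map_factor.
Qed.

Lemma refines_mono a (p : cantor -> FO 'I_a) N M :
  sep_level <= N -> N <= M -> refines p M -> refines p N.
Proof.
move=> HN NM [q qM qp]; have [r rM rP] := univ_map_refine HN NM.
by exists (fun v => r (q v)) => [|y]; [exact: morph_comp|rewrite qp rP].
Qed.

(** The left map is refined to one with a good graph by [refine_cond], and [lift_cond] for [k]
    copies that graph to the right. *)
Lemma bf_half h k N s : inG h -> inG k ->
  (forall N, refine_cond N h) -> (forall a b p q R, @lift_cond a b p q R k) ->
  bf_inv h k s ->
  exists s', [/\ bf_inv h k s', bf_ext s s' & refines (bf_l s') (sep_level + N)].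
Proof.
case: s => a pl pr hG kG hR kL [/= fl fr E gd].
have [M HM lM] := filtered_map_level fl.
(* The level is at least [M] so that the old map [pl] factors through the new one. *)
have [b [p [q [fp qM qp gp]]]] := hR (maxn N M).
have rf : refines p (sep_level + maxn N M) by exists q.
have [r rM rP] : exists2 r : FO 'I_b -> FO 'I_a, morph r & forall y, pl y = r (p y).
  apply: refines_factor rf fl _; apply: level_mono lM.
  by rewrite (leq_trans (leq_maxr N M)) // leq_addl.
have Er : img r (agraph h p) = agraph h pl by rewrite agraph_img //; congr (agraph h _); apply: funext.
have [|||p' [fp' rep_of' E']] := kL _ _ pr r (agraph h p) fr rM.
- exact: agraph_valid.
- by rewrite Er.
- by rewrite Er.
exists (BF p p'); split=> /=.
- by split.
- by exists r; split=> // y; rewrite /= ?rP.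
- by apply: refines_mono rf; rewrite ?leq_addr ?leq_add2l ?leq_maxl.
Qed.

Lemma bf_step h k N s : inG h -> inG k ->
  (forall N, refine_cond N h) -> (forall a b p q R, @lift_cond a b p q R h) ->
  (forall N, refine_cond N k) -> (forall a b p q R, @lift_cond a b p q R k) ->
  bf_inv h k s ->
  exists s', [/\ bf_inv h k s', bf_ext s s', refines (bf_l s') (sep_level + N) &
    refines (bf_r s') (sep_level + N)].
Proof.
move=> hG kG hR hL kR kL /(bf_half N hG kG hR kL) [[a pl pr] [[/= fl fr E gd] e1 r1]].
have [|[b ql qr] [[/= fl' fr' E' gd'] [q [/= qM qL qR]] r2]] :=
  @bf_half k h N (BF pr pl) kG hG kR hL; first by split; rewrite -?E.
exists (BF qr ql); split=> //=.
- by split; rewrite // -E'.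
- by apply: bf_ext_trans e1 _; exists q.
- move: r1 => [/= r rM rP]; exists (fun v => r (q v)) => [|y]; first exact: morph_comp.
  by rewrite qR rP.
Qed.

(** * The automorphism defined by an infinite back-and-forth sequence *)

Section Conjugate.
Variables h k : 'I_m -> S -> S.
Hypotheses (hG : inG h) (kG : inG k).
Variable sq : nat -> bf_state.
Hypothesis sq_inv : forall i, bf_inv h k (sq i).
Hypothesis sq_ext : forall i, bf_ext (sq i) (sq i.+1).
Hypothesis sq_l : forall i, refines (bf_l (sq i.+1)) (sep_level + i).
Hypothesis sq_r : forall i, refines (bf_r (sq i.+1)) (sep_level + i).

Let sq_ext_le i i' : i <= i' -> bf_ext (sq i) (sq i').
Proof.
move=> /subnK <-; elim: (i' - i) => [|d IH]; first exact: bf_ext_refl.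
exact: bf_ext_trans IH (sq_ext _).
Qed.

Definition conj_at i (f f' : S) := exists2 p : FO 'I_(bf_size (sq i)) -> Aobj,
  morph p & (forall y, sval f y = p (bf_l (sq i) y)) /\
            (forall y, sval f' y = p (bf_r (sq i) y)).

Let conj_at_mono i i' f f' : i <= i' -> conj_at i f f' -> conj_at i' f f'.
Proof.
move=> /sq_ext_le [q [qM ql qr]] [p pM [pl pr]]; exists (fun v => p (q v)).
  exact: morph_comp.
by split=> y; rewrite ?ql ?qr.
Qed.

(** Each value of [bf_l] is a vertex of the common graph, hence a translate of a value of [bf_r]. A
    morphism is thus determined on one side by its effect on the other. *)
Let vertex_l i y : exists y' b, bf_l (sq i) y = oact (bf_r (sq i) y') b.
Proof.
have [_ _ E _] := sq_inv i.
have : agraph h (bf_l (sq i)) j0 (bf_l (sq i) y) (transport (h j0) (bf_l (sq i)) y).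
  by exists y, 1%g; rewrite !oact1.
by rewrite E => -[y' [b [-> _]]]; exists y', b.
Qed.

Let vertex_r i y : exists y' b, bf_r (sq i) y = oact (bf_l (sq i) y') b.
Proof.
have [_ _ E _] := sq_inv i.
have : agraph k (bf_r (sq i)) j0 (bf_r (sq i) y) (transport (k j0) (bf_r (sq i)) y).
  by exists y, 1%g; rewrite !oact1.
by rewrite -E => -[y' [b [-> _]]]; exists y', b.
Qed.

Let conj_at_fun i f f1 f2 : conj_at i f f1 -> conj_at i f f2 -> f1 = f2.
Proof.
move=> [p pM [pl pr]] [q qM [ql qr]]; apply: fbp_inj; apply: funext => y.
have [y' [b E]] := vertex_r i y.
by rewrite pr qr E (proj1 pM) (proj1 qM) -pl -ql.
Qed.

Let conj_at_inj i f f1 f2 : conj_at i f1 f -> conj_at i f2 f -> f1 = f2.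
Proof.
move=> [p pM [pl pr]] [q qM [ql qr]]; apply: fbp_inj; apply: funext => y.
have [y' [b E]] := vertex_l i y.
by rewrite pl ql E (proj1 pM) (proj1 qM) -pr -qr.
Qed.

Let conj_total f : exists f' i, conj_at i f f'.
Proof.
have [N lf] := continuous_level (proj1 (svalP f)).
have [|p pM pE] := refines_factor (V := Aobj) (sq_l N) (svalP f).
  by apply: level_mono lf; rewrite leq_addl.
have [_ fr _ _] := sq_inv N.+1.
by exists (exist _ _ (filtered_map_comp pM fr)), N.+1, p.
Qed.

Let conj_onto f' : exists f i, conj_at i f f'.
Proof.
have [N lf] := continuous_level (proj1 (svalP f')).
have [|p pM pE] := refines_factor (V := Aobj) (sq_r N) (svalP f').
  by apply: level_mono lf; rewrite leq_addl.
have [fl _ _ _] := sq_inv N.+1.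
by exists (exist _ _ (filtered_map_comp pM fl)), N.+1, p.
Qed.

Let conj_op i f (a b : 'I_(ar f) -> S) :
  (forall l, conj_at i (a l) (b l)) -> conj_at i (fbp_op He a) (fbp_op He b).
Proof.
move=> H.
have H' l : exists p : FO 'I_(bf_size (sq i)) -> Aobj, morph p /\
    (forall y, sval (a l) y = p (bf_l (sq i) y)) /\
    (forall y, sval (b l) y = p (bf_r (sq i) y)).
  by have [p pM pP] := H l; exists p.
have [p Hp] := choice H'.
exists (fun v => @op f (fun l => p l v) : Aobj).
  split=> [v c|c] /=.
    rewrite aact_op; congr (@op f _); apply: funext => l.
    by case: (Hp l) => [[-> _] _].
  (* On [K] all the morphisms take the same value, a translate of the idempotent [e r], which the
     operation fixes. *)
  have [r [d ->]] := K_generated c.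
  have -> : (fun l => p l (inl (kact (idemK r) d))) = fun _ => aact (e r) d.
    by apply: funext => l; case: (Hp l) => [[_ pio] _]; exact: (pio (kact (idemK r) d)).
  by rewrite -aact_op He.
by split=> y /=; congr (@op f _); apply: funext => l; case: (Hp l) => _ [].
Qed.

(** At a late stage the [h]-transport of [bf_l (sq i)] factors through [bf_l] by a morphism [r].
    Equality of the graphs gives the same [r] for the [k]-transport on the right. *)
Let conj_tuple i f f' j : conj_at i f f' -> exists i', conj_at i' (h j f) (k j f').
Proof.
move=> [p pM [pl pr]]; have [fl fr _ _] := sq_inv i.
have fH := transport_funs (hG j) fl; have [N HN lN] := filtered_map_level fH.
pose i' := (maxn i N).+1.
have [|r rM rE] := refines_factor (sq_l (maxn i N)) fH.
  by apply: level_mono lN; rewrite (leq_trans (leq_maxr i N)) // leq_addl.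
have [q [qM ql qr]] : bf_ext (sq i) (sq i').
  by apply: sq_ext_le; rewrite leqW // leq_maxl.
have [_ _ E _] := sq_inv i'.
have Eh : bf_l (sq i) = fun y => q (bf_l (sq i') y) by apply: funext => y; rewrite ql.
have Ek : bf_r (sq i) = fun y => q (bf_r (sq i') y) by apply: funext => y; rewrite qr.
have rE' y : transport (k j) (bf_r (sq i)) y = r (bf_r (sq i') y).
  have : agraph k (bf_r (sq i')) j (bf_r (sq i') y) (transport (k j) (bf_r (sq i')) y).
    by exists y, 1%g; rewrite !oact1.
  rewrite -E => -[y' [b [E1 E2]]].
  rewrite Ek transport_morph // E2 E1 (proj1 qM) (proj1 rM) -rE; congr (oact _ b).
  by rewrite Eh transport_morph.
exists i', (fun v => p (r v)); first exact: morph_comp.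
have Ef : sval f = fun y => p (bf_l (sq i) y) by apply: funext.
have Ef' : sval f' = fun y => p (bf_r (sq i) y) by apply: funext.
split=> y.
  by rewrite -(transport_fbp _ (hG j)) Ef transport_morph // rE.
by rewrite -(transport_fbp _ (kG j)) Ef' transport_morph // rE'.
Qed.

Lemma conjugator : exists g, isaut g /\ forall j s, g (h j s) = k j (g s).
Proof.
have [g Hg] := choice conj_total; have [d Hd] := choice Hg.
have [g' Hg'] := choice conj_onto; have [d' Hd'] := choice Hg'.
have gE i f f' : conj_at i f f' -> g f = f'.
  move=> H; apply: (@conj_at_fun (maxn i (d f)) f).
    exact: conj_at_mono (leq_maxr _ _) (Hd f).
  exact: conj_at_mono (leq_maxl _ _) H.
exists g; split; last first.
  by move=> j s; have [i' H] := conj_tuple j (Hd s); apply: gE H.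
split.
  exists g' => f; last exact: gE (Hd' f).
  apply: (@conj_at_inj (maxn (d f) (d' (g f))) (g f)).
    exact: conj_at_mono (leq_maxr _ _) (Hd' _).
  exact: conj_at_mono (leq_maxl _ _) (Hd f).
move=> f a; apply: (gE (\max_l d (a l))); apply: conj_op => l.
exact: conj_at_mono (leq_bigmax _) (Hd (a l)).
Qed.
End Conjugate.

Lemma generic_conjugate h k : inG h -> inG k ->
  (forall i, gen_cond i h) -> (forall i, gen_cond i k) -> conj_orbit isaut h k.
Proof.
move=> hG kG /gen_cond_all [[p [fp pE]] hR hL] /gen_cond_all [[q [fq qE]] kR kL].
(* Here [k] is on the left, as [conj_orbit] asks for [g (k j s) = h j (g s)]. Both initial graphs
   are equality. *)
have s0 : bf_inv k h (BF q p).
  by split; rewrite //= ?qE ?pE //; apply: triv_good.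
have H (si : bf_state * nat) : exists s', bf_inv k h si.1 ->
    [/\ bf_inv k h s', bf_ext si.1 s', refines (bf_l s') (sep_level + si.2) &
    refines (bf_r s') (sep_level + si.2)].
  have [I|] := EM (bf_inv k h si.1); last by exists si.1.
  by have [s' Hs'] := bf_step si.2 kG hG kR kL hR hL I; exists s'.
have [nxt Hn] := choice H.
pose sq := fix sq i := if i is i'.+1 then nxt (sq i', i') else BF q p.
have sI i : bf_inv k h (sq i).
  by elim: i => // i IH; case: (Hn (sq i, i) IH).
have sP i := Hn (sq i, i) (sI i).
have [g [gA gE]] := @conjugator k h kG hG sq sI (fun i => let: And4 _ a _ _ := sP i in a)
  (fun i => let: And4 _ _ a _ := sP i in a) (fun i => let: And4 _ _ _ a := sP i in a).
by exists g.
Qed.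

Lemma generic_exists : exists h : 'I_m -> S -> S, generic isaut h.
Proof.
have [h hG hC] := baire gen_condP; exists h; split=> //.
exists gen_cond; split; first exact: gen_condP.
by move=> k kG kC; apply: generic_conjugate.
Qed.
End Tuples.

Lemma ample_generics_fbp : ample_generics isaut.
Proof.
case=> [|m]; last exact: (@generic_exists m.+1 ord0).
(* The power of exponent zero is a single point; longer tuples provide the index [ord0]. *)
exists (fun _ => id); split; first by case.
exists (fun _ _ => True); split.
  by move=> _; split=> [h _ _|h Fs hG]; [exists [::]|exists h].
move=> k _ _; exists id; split; last by case.
by split; [exists id|].
Qed.
End Filtered.

(** * Automorphisms of filtered Boolean powers *)

Section AutomorphismGroup.
Variables (F : Type) (ar : F -> nat) (A : finType).
Variable (op : forall f : F, ('I_(ar f) -> A) -> A).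

Definition aut_set := [set s : {perm A} |
  `[< forall f (a : 'I_(ar f) -> A), s (@op f a) = @op f (fun i => s (a i)) >]].

Lemma aut_group_set : group_set aut_set.
Proof.
apply/group_setP; split.
  rewrite inE; apply/asboolP => f a; rewrite perm1; congr (@op f _).
  by apply: funext => i; rewrite perm1.
move=> s t; rewrite !inE => /asboolP Hs /asboolP Ht; apply/asboolP => f a.
rewrite permM Hs Ht; congr (@op f _).
by apply: funext => i; rewrite permM.
Qed.
Definition aut_group := Group aut_group_set.

(** [subg_of] turns the group into a type. Permutations multiply from left to right, so this is a
    right action. *)
Definition aut_act (a : A) (b : subg_of aut_group) : A := sgval b a.

Lemma aut_act1 a : aut_act a 1%g = a.
Proof. by rewrite /aut_act perm1. Qed.
Lemma aut_actM a b c : aut_act a (b * c)%g = aut_act (aut_act a b) c.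
Proof. by rewrite /aut_act /= permM. Qed.
Lemma aut_act_faithful b c : (forall a, aut_act a b = aut_act a c) -> b = c.
Proof. by move=> H; apply: val_inj; apply/permP. Qed.
Lemma aut_act_op f (a : 'I_(ar f) -> A) b :
  aut_act (@op f a) b = @op f (fun i => aut_act (a i) b).
Proof. by have := subgP b; rewrite /= inE => /asboolP; apply. Qed.

Lemma onto_hom_aut (B : A -> A) : (forall a, exists b, B b = a) ->
  (forall f (a : 'I_(ar f) -> A), B (@op f a) = @op f (fun i => B (a i))) ->
  exists b, forall a, B a = aut_act a b.
Proof.
move=> Bon BH; have [C HC] := choice Bon.
have CI : injective C := can_inj HC.
have BE a : B a = ((perm CI)^-1)%g a.
  by rewrite -{1}(permKV (perm CI) a) permE HC.
have sin : ((perm CI)^-1)%g \in aut_group.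
  rewrite inE; apply/asboolP => f a; rewrite -BE BH; congr (@op f _).
  by apply: funext => i; rewrite BE.
by exists (subg aut_group (perm CI)^-1%g) => a; rewrite /aut_act subgK.
Qed.
End AutomorphismGroup.

(** * Surjective homomorphisms from the filtered Boolean power to [A] are evaluations *)

Section Representation.
Variables (F : Type) (ar : F -> nat) (A : finType).
Variable (op : forall f : F, ('I_(ar f) -> A) -> A).
Hypotheses (Hsimple : simple_alg op) (Hmalcev : malcev op) (Hnonab : ~ abelian_alg op).
Variables (n : nat) (e : 'I_n -> A) (He : forall i, is_idempotent op (e i)).
Variables (x : 'I_n -> cantor) (Hx : injective x).

Notation S := (fbp x e).
Notation opS := (fbp_op (x := x) He).

Lemma term_eval_fbp V (v : V -> S) (t : term ar V) y :
  sval (term_eval opS v t) y = term_eval op (fun i => sval (v i) y) t.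
Proof. by elim: t => //= f args IH; congr (@op f _); apply: funext. Qed.

Lemma fbp_value y a : (forall i, y <> x i) -> exists f : S, sval f y = a.
Proof.
move=> yx.
(* Adjoining [y] to the points gives a level that separates it from all of them. *)
pose x' (o : 'I_n.+1) := if unlift ord0 o is Some k then x k else y.
have x'I : injective x'.
  move=> o o'; rewrite /x'; case: (unliftP ord0 o) => [k ->|->];
  case: (unliftP ord0 o') => [k' ->|->] //.
  - by move/Hx => ->.
  - by move=> E; case: (yx k).
  - by move=> E; case: (yx k').
have [N HN] := separating_level x'I.
have sepx i k : bits N (x i) = bits N (x k) -> i = k.
  move=> E; have := HN (lift ord0 i) (lift ord0 k); rewrite /x' !liftK => /(_ E).
  exact: lift_inj.
have sepy i : bits N y <> bits N (x i).
  by move=> E; have := HN ord0 (lift ord0 i); rewrite /x' liftK unlift_none => /(_ E).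
pose g z := if [pick i | bits N z == bits N (x i)] is Some i then e i else a.
have Hg : in_fbp x e g.
  split; first by apply: (@level_continuous _ N) => z w E; rewrite /g E.
  move=> i; rewrite /g; case: pickP => [k /eqP/sepx -> //|/(_ i)]; by rewrite eqxx.
exists (exist _ _ Hg); rewrite /= /g; case: pickP => // i /eqP /sepy [].
Qed.

Lemma patch_proof (U : cantor -> bool) (f g : S) : cantor_continuous U ->
  in_fbp x e (fun y => if U y then sval f y else sval g y).
Proof.
case: f g => f [cf fx] [g [cg gx]] /= cU; split; first exact: continuous_if.
by move=> i; rewrite fx gx; case: ifP.
Qed.
Definition patch U (cU : cantor_continuous U) (f g : S) : S :=
  exist _ _ (patch_proof f g cU).

Section Homomorphism.
Variable th : S -> A.
Hypothesis thH : forall f (a : 'I_(ar f) -> S), th (opS a) = @op f (fun i => th (a i)).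
Hypothesis th_onto : forall a, exists f, th f = a.

Definition depends_on (U : cantor -> bool) :=
  forall f g : S, (forall y, U y -> sval f y = sval g y) -> th f = th g.

(** Patching along [U] turns [th] into a homomorphism from the square of [S] onto [A], which factors
    through a coordinate. *)
Lemma depends_or (U : cantor -> bool) : cantor_continuous U ->
  depends_on U \/ depends_on (fun y => ~~ U y).
Proof.
move=> cU; have [t tP] := Hmalcev.
have tS (a b : S) : term_eval opS (triple a a b) t = b /\ term_eval opS (triple b a a) t = b.
  have tr (c d g : S) y : (fun i => sval (triple c d g i) y) = triple (sval c y) (sval d y) (sval g y).
    by apply: funext => -[[|[|[|k]]] hk].
  by split; apply: fbp_inj; apply: funext => y; rewrite term_eval_fbp tr;
    have [] := tP (sval a y) (sval b y).
have [||H|H] := @factor_through_coordinate _ _ _ op t tP Hsimple Hnonab S opS tS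
   (fun f g => th (patch cU f g)).
- move=> f a b; rewrite -thH; congr th; apply: fbp_inj; apply: funext => y /=.
  by case: ifP.
- move=> a; have [f <-] := th_onto a; exists f, f; congr th.
  by apply: fbp_inj; apply: funext => y /=; case: ifP.
- left=> f g E; have E1 : patch cU f f = f.
    by apply: fbp_inj; apply: funext => y /=; case: ifP.
  have E2 : patch cU f g = g.
    by apply: fbp_inj; apply: funext => y /=; case: ifP => // /E.
  by rewrite -{1}E1 -[in RHS]E2; apply: H.
- right=> f g E; have E1 : patch cU f f = f.
    by apply: fbp_inj; apply: funext => y /=; case: ifP.
  have E2 : patch cU g f = g.
    by apply: fbp_inj; apply: funext => y /=; case: ifP => // /negbT/E.
  by rewrite -{1}E1 -[in RHS]E2; apply: H.
Qed.

Lemma hom_point : exists z b, forall f, th f = aut_act (op := op) (sval f z) b.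
Proof.
(* The clopen sets on which [th] depends single out a point, found bit by bit. *)
pose z : cantor := fun k => `[< depends_on (fun y => y k) >].
have dep1 k : depends_on (fun y => y k == z k).
  rewrite /z; case: asboolP => [H|H] f g E.
    by apply: H => y yk; apply: E; rewrite yk.
  have [//|H'] := depends_or (continuous_map_id k).
  by apply: H' => y /negPf yk; apply: E; rewrite yk.
have cB N : cantor_continuous (fun y => bits N y == bits N z).
  by apply: (continuous_comp (fun u => u == bits N z)); apply: continuous_bits.
have depN N : depends_on (fun y => bits N y == bits N z).
  elim: N => [|N IH] f g E.
    by congr th; apply: fbp_inj; apply: funext => y; apply: E; apply/eqP/bitsP.
  have -> : th f = th (patch (cB N) f g) by apply: IH => y /= ->.
  apply: (dep1 N) => y /eqP yN /=; case: ifP => // /eqP/bitsP H; apply: E.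
  apply/eqP/bitsP => k; rewrite ltnS leq_eqVlt => /orP [/eqP -> //|]; exact: H.
have thz f g : sval f z = sval g z -> th f = th g.
  move=> E; have [N1 H1] := proj1 (svalP f) z; have [N2 H2] := proj1 (svalP g) z.
  apply: (depN (maxn N1 N2)) => y /eqP/bitsP H.
  by rewrite (loc_const_mono (leq_maxl _ _) H1 H) (loc_const_mono (leq_maxr _ _) H2 H).
(* Otherwise [th] would be constant, while [A] has two elements. *)
have zx i : z <> x i.
  move=> zi; have [[a [b ab]] _] := Hsimple; apply: ab.
  have [f <-] := th_onto a; have [g <-] := th_onto b.
  by apply: thz; rewrite zi (proj2 (svalP f)) (proj2 (svalP g)).
have [v Hv] := choice (fun a => fbp_value a zx).
have thE f : th f = th (v (sval f z)) by apply: thz; rewrite Hv.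
have [||b Hb] := @onto_hom_aut _ _ _ op (fun a => th (v a)).
- by move=> a; have [f <-] := th_onto a; exists (sval f z).
- move=> f a; rewrite -thH; apply: thz; rewrite Hv /=; congr (@op f _).
  by apply: funext => i; rewrite Hv.
by exists z, b => f; rewrite thE Hb.
Qed.
End Homomorphism.

(** Away from the [x i], [h] followed by evaluation at [y] is onto [A], so [hom_point] applies. At
    [x i] it is constant and equals evaluation at [x i]. *)
Lemma aut_rep (h : S -> S) : is_aut opS h -> exists pb, rep (@aut_act _ _ _ op) h pb.
Proof.
move=> [[h' hh' h'h] hH].
have H y : exists pb : cantor * subg_of (aut_group op),
    forall f, sval (h f) y = aut_act (sval f pb.1) pb.2.
  have [[i ->]|yx] := EM (exists i, y = x i).
    exists (x i, 1%g) => f.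
    by rewrite aut_act1 (proj2 (svalP f)) (proj2 (svalP (h f))).
  have [||z [b Hb]] := @hom_point (fun f => sval (h f) y); last by exists (z, b).
    by move=> f a; rewrite hH.
  move=> a; have [|f Ef] := @fbp_value y a; last by exists (h' f); rewrite h'h.
  by move=> i E; apply: yx; exists i.
have [pb Hpb] := choice H.
by exists (fun y => (pb y).1, fun y => (pb y).2).
Qed.
End Representation.

Theorem theorem1p1
  (F : Type) (ar : F -> nat)
  (A : finType) (op : forall f : F, ('I_(ar f) -> A) -> A)
  (Hsimple : simple_alg op) (Hmalcev : malcev op) (Hnonab : ~ abelian_alg op)
  (n : nat) (e : 'I_n -> A) (He : forall i, is_idempotent op (e i))
  (x : 'I_n -> cantor) (Hx : injective x) :
  ample_generics (is_aut (fbp_op (x := x) He)).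
Proof.
apply: (ample_generics_fbp (@aut_act1 _ _ _ op) (@aut_actM _ _ _ op)
  (@aut_act_faithful _ _ _ op) (@aut_act_op _ _ _ op) (proj1 Hsimple) Hx).
exact: aut_rep.
Qed.
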